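(* Let $\beta$ be a well-formed execution of the SODA$_{\text{err}}$ algorithm described in the context. Then every operation in $\beta$ invoked by a non-faulty client completes.
   Context: System model: asynchronous message passing with writers $\mathcal{W}$, readers $\mathcal{R}$ and $n$ servers $\mathcal{S}$ ordered $s_1<\dots<s_n$; reliable point-to-point channels between every client and server and every two servers (eventual delivery to non-crashed destinations even if the sender crashes; arbitrary delays and order). Crash failures only; any number of clients and at most $f$ servers crash, $1\le f\le (n-1)/2$. Well-formed: each client invokes an operation only after its previous one completed. Errors: when a server sends its locally stored coded element to a reader (in response to the reader's registration), the element read from its disk may be erroneous (an arbitrary field element instead of the correct one), without the server knowing; at most $e$ such erroneous coded elements occur, while tags, metadata and coded elements merely relayed upon delivery from a write are never erroneous. Coding: an $[n,k]$ MDS code with $k=n-f-2e$, encoder $\Phi$ ($\Phi_s(v)$ coded element for server $s$), and decoder $\Phi_{err}^{-1}$ which recovers $v$ from any $k+2e$ coded elements (with known indices) of which at most $e$ are erroneous. Tags $t=(z,w)$, $z\in\mathbb{N}$, $w\in\mathcal{W}$, ordered lexicographically; initial tag $t_0$; initial value $v_0$. Dissemination primitives. md-value-send$(t,v)$: $(t,v)$ sent to $s_1,\dots,s_{f+1}$; each $s_i$ on first receipt forwards it to $s_{i+1},\dots,s_{f+1}$, sends $(t,\Phi_{s'}(v))$ to every other server $s'$, and delivers $(t,\Phi_{s_i}(v))$; other servers deliver the received coded element (md-value-deliver). md-meta-send$(m)$: same, delivering $m$ itself at every server (md-meta-deliver). SODA$_{\text{err}}$ write$(v)$ at $w$: query tags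 of all servers, wait for a majority, take max $t_{max}$; $t_w=(t_{max}.z+1,w)$; md-value-send$(t_w,v)$; wait for $k$ acknowledgments. SODA$_{\text{err}}$ read at $r$: query tags, wait for a majority, take max $t_r$; md-meta-send(READ-VALUE,$(r,t_r)$); collect pairs $(t,c)$ until $k+2e$ of them from distinct servers share a tag; decode with $\Phi_{err}^{-1}$; md-meta-send(READ-COMPLETE,$(r,t_r)$); return value. SODA$_{\text{err}}$ server $s$: state $(t,c_s)$ (initially $(t_0,\Phi_s(v_0))$), set $R_c$ of registered $(r,t_r)$, set $H$ of triples $(t,s',r)$, both initially empty. Replies to tag queries with its tag. On md-value-deliver$(t_w,c'_s)$: for each $(r,t_r)\in R_c$ with $t_w\ge t_r$, send $(t_w,c'_s)$ to $r$, add $(t_w,s,r)$ to $H$, md-meta-send(READ-DISPERSE,$(t_w,s,r)$); if $t_w>t$ store $(t_w,c'_s)$; acknowledge the writer. On md-meta-deliver(READ-VALUE,$(r,t_r)$): if $(t_0,s,r)\in H$ remove $r$'s triples from $H$; else register $(r,t_r)$ in $R_c$ and if $t\ge t_r$ send $(t,c_s)$ to $r$, add $(t,s,r)$ to $H$, md-meta-send(READ-DISPERSE,$(t,s,r)$). On md-meta-deliver(READ-COMPLETE,$(r,t_r)$): if $r$ is registered, unregister it and remove its triples from $H$; else add $(t_0,s,r)$ to $H$. On md-meta-deliver(READ-DISPERSE,$(t,s',r)$): add it to $H$; if $r$ is registered and $H$ has at least $k+2e$ triples with tag $t$ and reader $r$, unregister $r$ and remove its triples from $H$.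
   Formalization: The identifier r in READ-VALUE, READ-COMPLETE, READ-DISPERSE, R_c and H is unique to each read operation (reader plus operation number), and tag replies carry their query's number; with r the reader alone, a delayed READ-COMPLETE of an earlier read can block a later read forever. *)

(* Defs.v *)
From HB Require Import structures.
From mathcomp Require Import all_boot.
From Stdlib Require List.

Set Implicit Arguments.
Unset Strict Implicit.
Unset Printing Implicit Defensive.

Definition tag := (nat * nat)%type.
Definition t0 : tag := (0, 0).
Definition tag_lt (a b : tag) : bool :=
  (a.1 < b.1) || ((a.1 == b.1) && (a.2 < b.2)).
Definition tag_le (a b : tag) : bool := (a == b) || tag_lt a b.
Definition tag_max (a b : tag) : tag := if tag_lt a b then b else a.
Definition max_tag (s : seq tag) : tag := foldr tag_max t0 s.

(* identifier of a read operation: (reader id, operation number) *)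
Definition rid := (nat * nat)%type.

(* processes: writers, readers (identified by nat) and servers s_1..s_n
   (identified by 'I_n, s_i being the ordinal i-1). *)
Inductive proc (n : nat) := PW of nat | PR of nat | PS of 'I_n.
Arguments PW {n}. Arguments PR {n}. Arguments PS {n}.
Definition proc_enc n (p : proc n) : nat + nat + 'I_n :=
  match p with PW w => inl (inl w) | PR r => inl (inr r) | PS s => inr s end.
Definition proc_dec n (x : nat + nat + 'I_n) : proc n :=
  match x with inl (inl w) => PW w | inl (inr r) => PR r | inr s => PS s end.
Lemma proc_encK n : cancel (@proc_enc n) (@proc_dec n). Proof. by case. Qed.
HB.instance Definition _ n := Equality.copy (proc n) (can_type (@proc_encK n)).

(* identifier of one invocation of md-value-send / md-meta-send:
   (invoking process, local counter). "First receipt" refers to it. *)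
Definition iid n := (proc n * nat)%type.

Inductive meta (n : nat) :=
  | RV of rid & tag
  | RC of rid & tag
  | RD of tag & 'I_n & rid.
Arguments RV {n}. Arguments RC {n}. Arguments RD {n}.

Inductive payload (n : nat) (V C : Type) :=
  | PQuery of nat
  | PRTag  of nat & tag
  | PVal   of iid n & tag & V
  | PCod   of iid n & tag & C
  | PAck   of tag
  | PMeta  of iid n & meta n
  | PData  of rid & tag & C.
Arguments PQuery {n V C}. Arguments PRTag {n V C}. Arguments PVal {n V C}.
Arguments PCod {n V C}. Arguments PAck {n V C}. Arguments PMeta {n V C}.
Arguments PData {n V C}.

Section SODA.
Variables (n f e : nat) (V C : Type).
Variable Phi : 'I_n -> V -> C.
Variable Dec : seq ('I_n * C) -> V.
Variable v0 : V.

Definition k := n - f - 2 * e.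

Local Notation proc := (proc n).
Local Notation payload := (payload n V C).
Definition out := seq (proc * payload).

Definition prims : seq 'I_n := filter (fun s : 'I_n => s < f.+1) (enum 'I_n).
Definition fwd (s : 'I_n) : seq 'I_n :=
  filter (fun s' : 'I_n => (s < s') && (s' < f.+1)) (enum 'I_n).
Definition nonprims : seq 'I_n := filter (fun s : 'I_n => f.+1 <= s) (enum 'I_n).

Definition md_meta (src : proc) (cnt : nat) (m : meta n) : out :=
  [seq (PS s', PMeta (src, cnt) m) | s' <- prims].

Record sstate := SState {
  s_tag : tag; s_c : C;
  s_R : seq (rid * tag);
  s_H : seq (tag * 'I_n * rid);
  s_seen : seq (iid n);
  s_cnt : nat;
  s_crashed : bool }.

Definition addH (x : tag * 'I_n * rid) (H : seq (tag * 'I_n * rid)) :=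
  if x \in H then H else rcons H x.
Definition remR (r : rid) (R : seq (rid * tag)) := [seq x <- R | x.1 != r].
Definition remH (r : rid) (H : seq (tag * 'I_n * rid)) := [seq x <- H | x.2 != r].
Definition registered (r : rid) (R : seq (rid * tag)) := has (fun x => x.1 == r) R.

Definition value_deliver (s : 'I_n) (st : sstate) (tw : tag) (c' : C)
    : sstate * out :=
  let regs := [seq x <- s_R st | tag_le x.2 tw] in
  let '(H, cnt, o) :=
    foldl (fun acc (x : rid * tag) =>
             let '(H, cnt, o) := acc in
             (addH (tw, s, x.1) H, cnt.+1,
              o ++ (PR x.1.1, PData x.1 tw c') :: md_meta (PS s) cnt (RD tw s x.1)))
          (s_H st, s_cnt st, [::]) regs in
  let tc := if tag_lt (s_tag st) tw then (tw, c') else (s_tag st, s_c st) in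
  (SState tc.1 tc.2 (s_R st) H (s_seen st) cnt (s_crashed st),
   rcons o (PW tw.2, PAck tw)).

(* md-meta-deliver (m) at server s; [err] is the possibly erroneous
   element read from disk; the boolean result says whether an erroneous
   element was sent. *)
Definition meta_deliver (s : 'I_n) (st : sstate) (m : meta n) (err : option C)
    : sstate * out * bool :=
  let: SState t c R H seen cnt cr := st in
  match m with
  | RV r tr =>
      if (t0, s, r) \in H then (SState t c R (remH r H) seen cnt cr, [::], false)
      else
        let R' := if (r, tr) \in R then R else rcons R (r, tr) in
        if tag_le tr t then
          let c1 := if err is Some c' then c' else c in
          (SState t c R' (addH (t, s, r) H) seen cnt.+1 cr,
           (PR r.1, PData r t c1) :: md_meta (PS s) cnt (RD t s r),
           if err is Some _ then true else false)
        else (SState t c R' H seen cnt cr, [::], false)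
  | RC r tr =>
      if registered r R then (SState t c (remR r R) (remH r H) seen cnt cr, [::], false)
      else (SState t c R (addH (t0, s, r) H) seen cnt cr, [::], false)
  | RD t' s' r =>
      let H' := addH (t', s', r) H in
      if registered r R &&
         (k + 2 * e <= count (fun x => (x.1.1 == t') && (x.2 == r)) H')
      then (SState t c (remR r R) (remH r H') seen cnt cr, [::], false)
      else (SState t c R H' seen cnt cr, [::], false)
  end.

Definition mark_seen (st : sstate) (id : iid n) : sstate :=
  SState (s_tag st) (s_c st) (s_R st) (s_H st) (id :: s_seen st) (s_cnt st)
         (s_crashed st).

Definition server_recv (s : 'I_n) (st : sstate) (src : proc) (p : payload)
    (err : option C) : sstate * out * bool :=
  match p with
  | PQuery op => (st, [:: (src, PRTag op (s_tag st))], false)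
  | PVal id t v =>
      if (s < f.+1) && (id \notin s_seen st) then
        let o1 := [seq (PS s', PVal id t v) | s' <- fwd s]
                  ++ [seq (PS s', PCod id t (Phi s' v)) | s' <- nonprims] in
        let '(st2, o2) := value_deliver s (mark_seen st id) t (Phi s v) in
        (st2, o1 ++ o2, false)
      else (st, [::], false)
  | PCod id t c =>
      if (f.+1 <= s) && (id \notin s_seen st) then
        let '(st2, o2) := value_deliver s (mark_seen st id) t c in (st2, o2, false)
      else (st, [::], false)
  | PMeta id m =>
      if id \notin s_seen st then
        let o1 := if s < f.+1 then
                    [seq (PS s', PMeta id m) | s' <- fwd s]
                    ++ [seq (PS s', PMeta id m) | s' <- nonprims]
                  else [::] in
        let '(st2, o2, b) := meta_deliver s (mark_seen st id) m err in
        (st2, o1 ++ o2, b)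
      else (st, [::], false)
  | _ => (st, [::], false)
  end.

Inductive wstatus :=
  | WIdle
  | WQuery of nat & V & seq ('I_n * tag)
  | WAck of tag & seq 'I_n.
Record wstate := WState { w_status : wstatus; w_op : nat; w_crashed : bool }.

Definition writer_invoke (st : wstate) (v : V) : wstate * out :=
  let op := (w_op st).+1 in
  (WState (WQuery op v [::]) op (w_crashed st),
   [seq (PS s, PQuery op) | s <- enum 'I_n]).

Definition writer_recv (w : nat) (st : wstate) (src : proc) (p : payload)
    : wstate * out :=
  match src, p, w_status st with
  | PS s, PRTag op t, WQuery op0 v reps =>
      if (op == op0) && (s \notin unzip1 reps) then
        let reps' := rcons reps (s, t) in
        if n < 2 * size reps' then
          let tm := max_tag (unzip2 reps') in
          let tw := (tm.1.+1, w) in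
          (WState (WAck tw [::]) (w_op st) (w_crashed st),
           [seq (PS s', PVal (PW w, op0) tw v) | s' <- prims])
        else (WState (WQuery op0 v reps') (w_op st) (w_crashed st), [::])
      else (st, [::])
  | PS s, PAck t, WAck tw acks =>
      if (t == tw) && (s \notin acks) then
        let acks' := rcons acks s in
        if k <= size acks' then (WState WIdle (w_op st) (w_crashed st), [::])
        else (WState (WAck tw acks') (w_op st) (w_crashed st), [::])
      else (st, [::])
  | _, _, _ => (st, [::])
  end.

Inductive rstatus :=
  | RIdle
  | RQuery of nat & seq ('I_n * tag)
  | RColl of nat & tag & seq ('I_n * tag * C).
Record rstate := RState { r_status : rstatus; r_op : nat; r_val : V;
                          r_crashed : bool }.

Definition reader_invoke (st : rstate) : rstate * out :=
  let op := (r_op st).+1 in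
  (RState (RQuery op [::]) op (r_val st) (r_crashed st),
   [seq (PS s, PQuery op) | s <- enum 'I_n]).

Definition reader_recv (r : nat) (st : rstate) (src : proc) (p : payload)
    : rstate * out :=
  match src, p, r_status st with
  | PS s, PRTag op t, RQuery op0 reps =>
      if (op == op0) && (s \notin unzip1 reps) then
        let reps' := rcons reps (s, t) in
        if n < 2 * size reps' then
          let tr := max_tag (unzip2 reps') in
          (RState (RColl op0 tr [::]) (r_op st) (r_val st) (r_crashed st),
           md_meta (PR r) (2 * op0) (RV (r, op0) tr))
        else (RState (RQuery op0 reps') (r_op st) (r_val st) (r_crashed st), [::])
      else (st, [::])
  | PS s, PData rd t c, RColl op0 tr pairs =>
      if (rd == (r, op0)) && ~~ has (fun x => (x.1.1 == s) && (x.1.2 == t)) pairs then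
        let pairs' := rcons pairs (s, t, c) in
        let sel := [seq (x.1.1, x.2) | x <- [seq x <- pairs' | x.1.2 == t]] in
        if k + 2 * e <= size sel then
          (RState RIdle (r_op st) (Dec sel) (r_crashed st),
           md_meta (PR r) (2 * op0).+1 (RC (r, op0) tr))
        else (RState (RColl op0 tr pairs') (r_op st) (r_val st) (r_crashed st), [::])
      else (st, [::])
  | _, _, _ => (st, [::])
  end.

Record msg := Msg { mid : nat; msrc : proc; mdst : proc; mpay : payload }.

Record gstate := G {
  gS : 'I_n -> sstate; gW : nat -> wstate; gR : nat -> rstate;
  gnet : seq msg;
  gnext : nat;
  gerr : nat }.

Definition crashed (g : gstate) (p : proc) : bool :=
  match p with
  | PW w => w_crashed (gW g w)
  | PR r => r_crashed (gR g r)
  | PS s => s_crashed (gS g s)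
  end.

Fixpoint mkmsgs (src : proc) (id : nat) (o : out) : seq msg :=
  match o with
  | [::] => [::]
  | (d, p) :: o' => Msg id src d p :: mkmsgs src id.+1 o'
  end.

Definition sendg (g : gstate) (src : proc) (o : out) : gstate :=
  G (gS g) (gW g) (gR g) (gnet g ++ mkmsgs src (gnext g) o)
    (gnext g + size o) (gerr g).

(* [cut = Some j]: the process crashes during the step, after having
   sent only the first j messages of the step, in program order. *)
Definition cut_out (cut : option nat) (o : out) : out :=
  if cut is Some j then take j o else o.
Definition cut_crash (cut : option nat) (b : bool) : bool :=
  if cut is Some _ then true else b.

Definition setS (g : gstate) (s : 'I_n) (st : sstate) : gstate :=
  G (fun s' => if s' == s then st else gS g s') (gW g) (gR g)
    (gnet g) (gnext g) (gerr g).
Definition setW (g : gstate) (w : nat) (st : wstate) : gstate :=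
  G (gS g) (fun w' => if w' == w then st else gW g w') (gR g)
    (gnet g) (gnext g) (gerr g).
Definition setR (g : gstate) (r : nat) (st : rstate) : gstate :=
  G (gS g) (gW g) (fun r' => if r' == r then st else gR g r')
    (gnet g) (gnext g) (gerr g).
Definition incr_err (g : gstate) (b : bool) : gstate :=
  G (gS g) (gW g) (gR g) (gnet g) (gnext g) (gerr g + b).

Definition commitS g s (st : sstate) (o : out) cut (used : bool) : gstate :=
  let st' := SState (s_tag st) (s_c st) (s_R st) (s_H st) (s_seen st)
                    (s_cnt st) (cut_crash cut (s_crashed st)) in
  incr_err (sendg (setS g s st') (PS s) (cut_out cut o)) used.
Definition commitW g w (st : wstate) (o : out) cut : gstate :=
  let st' := WState (w_status st) (w_op st) (cut_crash cut (w_crashed st)) in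
  sendg (setW g w st') (PW w) (cut_out cut o).
Definition commitR g r (st : rstate) (o : out) cut : gstate :=
  let st' := RState (r_status st) (r_op st) (r_val st)
                    (cut_crash cut (r_crashed st)) in
  sendg (setR g r st') (PR r) (cut_out cut o).

Definition remove_msg (g : gstate) (m : msg) : gstate :=
  G (gS g) (gW g) (gR g) [seq m' <- gnet g | mid m' != mid m]
    (gnext g) (gerr g).

Definition deliver (g : gstate) (m : msg) (err : option C) (cut : option nat)
    : gstate :=
  let g0 := remove_msg g m in
  match mdst m with
  | PS s => let '(st, o, used) := server_recv s (gS g0 s) (msrc m) (mpay m) err in
            commitS g0 s st o cut used
  | PW w => let '(st, o) := writer_recv w (gW g0 w) (msrc m) (mpay m) in
            commitW g0 w st o cut
  | PR r => let '(st, o) := reader_recv r (gR g0 r) (msrc m) (mpay m) in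
            commitR g0 r st o cut
  end.

Definition crash (g : gstate) (p : proc) : gstate :=
  match p with
  | PW w => let st := gW g w in setW g w (WState (w_status st) (w_op st) true)
  | PR r => let st := gR g r in setR g r (RState (r_status st) (r_op st) (r_val st) true)
  | PS s => let st := gS g s in
            setS g s (SState (s_tag st) (s_c st) (s_R st) (s_H st) (s_seen st)
                             (s_cnt st) true)
  end.

Inductive step : gstate -> gstate -> Prop :=
  | step_invoke_write g w v cut :
      ~~ w_crashed (gW g w) -> w_status (gW g w) = WIdle ->
      step g (let '(st, o) := writer_invoke (gW g w) v in commitW g w st o cut)
  | step_invoke_read g r cut :
      ~~ r_crashed (gR g r) -> r_status (gR g r) = RIdle ->
      step g (let '(st, o) := reader_invoke (gR g r) in commitR g r st o cut)
  | step_deliver g m err cut :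
      List.In m (gnet g) -> ~~ crashed g (mdst m) ->
      step g (deliver g m err cut)
  | step_crash g p :
      ~~ crashed g p -> step g (crash g p).

Definition init : gstate :=
  G (fun s => SState t0 (Phi s v0) [::] [::] [::] 0 false)
    (fun _ => WState WIdle 0 false)
    (fun _ => RState RIdle 0 v0 false)
    [::] 0 0.

(* An execution: starts in the initial state; each transition is a step
   or a stutter (finite executions stutter forever at the end).
   Clients are well-formed by construction (invocation only when idle). *)
Definition execution (sigma : nat -> gstate) : Prop :=
  sigma 0 = init /\ forall i, step (sigma i) (sigma i.+1) \/ sigma i.+1 = sigma i.

Definition reliable_channels (sigma : nat -> gstate) : Prop :=
  forall i m, List.In m (gnet (sigma i)) ->
    (forall j, ~~ crashed (sigma j) (mdst m)) ->
    exists j, i <= j /\ ~ List.In m (gnet (sigma j)).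

Definition at_most_f_server_crashes (sigma : nat -> gstate) : Prop :=
  forall i, count (fun s => s_crashed (gS (sigma i) s)) (enum 'I_n) <= f.

Definition at_most_e_errors (sigma : nat -> gstate) : Prop :=
  forall i, gerr (sigma i) <= e.

Definition is_client (p : proc) : bool := if p is PS _ then false else true.

Definition client_idle (g : gstate) (p : proc) : Prop :=
  match p with
  | PW w => w_status (gW g w) = WIdle
  | PR r => r_status (gR g r) = RIdle
  | PS _ => False
  end.

Definition err_decoder : Prop :=
  forall (v : V) (S : seq 'I_n) (cs : 'I_n -> C),
    uniq S -> size S = k + 2 * e ->
    (exists E : seq 'I_n, size E <= e /\
       forall s, s \in S -> s \notin E -> cs s = Phi s v) ->
    Dec [seq (s, cs s) | s <- S] = v.

End SODA.

(* Main.v *)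
(* Consider a read that stays forever in its collecting phase with tag [tr], and let
   [N] be the set of non-faulty servers, so [|N| >= n - f = k + 2e].  A server only
   forgets the reader after learning that [n - f] servers sent it elements of one
   tag; these would reach the reader, so from some time [T] on all of [N] is
   registered.  The tag [tr] was reported by a server that was alive after
   delivering it, hence it was relayed to everybody and the tags on [N] are at
   least [tr] from [T] on.  Let [tm] be the largest tag stored on [N] at time [T].
   A server of [N] with tag [tm] at [T] has sent its element to the reader; every
   other one has a smaller tag, so it delivers [tm] after [T], while the reader is
   registered, and sends the element then.  Thus [n - f] servers send elements with
   tag [tm] and the read finishes.  The other phases only wait for replies that all
   of [N] send.

   The safety part is an inductive invariant relating the global state to the set
   of all messages sent so far. *)

Require Import Defs.
From HB Require Import structures.
From mathcomp Require Import all_boot zify.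
From Stdlib Require Import Classical FunctionalExtensionality PropExtensionality.

Set Implicit Arguments.
Unset Strict Implicit.
Unset Printing Implicit Defensive.

(** * Sequences and tags *)

Section ListIn.

(** The obstacle is the crash in mid-step: the state of the process is updated in full while only a
    prefix of its messages leaves. Assertions about what a server has sent are therefore made only
    for servers that have not crashed, and each message is justified by what was sent before it: an
    element precedes the READ-DISPERSE that announces it, and copies go to the relays in increasing
    order. Assertions about a read carry the alternative that the read is over. This makes them
    stable, and it covers the one log entry that stands for no element: the triple with tag [t0]
    left by a READ-COMPLETE that overtakes its READ-VALUE. A read assumed to hang is never over, so
    the alternative is discharged at the end. Writes are followed through the identifier of their
    md-value-send. Two writes may share a tag, but an identifier has a single one. Whether a server
    has caught up with the largest tag is thus decided by whether it has seen an identifier under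
    which that tag was spread. *)

Lemma In_cat T (x : T) a b : List.In x (a ++ b) <-> List.In x a \/ List.In x b.
Proof. by elim: a => /= [|y a ->]; tauto. Qed.

Lemma In_map T U (h : T -> U) y s :
  List.In y (map h s) <-> exists2 x, List.In x s & y = h x.
Proof.
elim: s => /= [|z s IH]; first by split=> [//|[]].
split=> [[<-|/IH[x Hx E]]|[x [<-|Hx] E]]; first by exists z; [left|].
- by exists x; [right|].
- by left.
by right; apply/IH; exists x.
Qed.

Lemma In_mem (T : eqType) (x : T) s : List.In x s <-> x \in s.
Proof.
elim: s => //= y s IH; rewrite in_cons; split.
  by case=> [->|/IH ->]; rewrite ?eqxx ?orbT.
by case/orP=> [/eqP ->|/IH]; [left|right].
Qed.

Lemma In_filter T (P : pred T) x s :
  List.In x (filter P s) <-> List.In x s /\ P x.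
Proof.
elim: s => /= [|y s IH]; first by tauto.
case: ifP => Py /=; rewrite IH; first by split=> [[<-|]|[[]]]; tauto.
by split=> [|[[E|]]]; [tauto|rewrite -E Py|tauto].
Qed.

Lemma In_take T (x : T) j s : List.In x (take j s) -> List.In x s.
Proof. by rewrite -{2}(cat_take_drop j s) In_cat; left. Qed.

End ListIn.

Lemma tag_le_refl t : tag_le t t. Proof. by rewrite /tag_le eqxx. Qed.

Lemma tag_leE a b : tag_le a b = (a.1 < b.1) || ((a.1 == b.1) && (a.2 <= b.2)).
Proof.
rewrite /tag_le /tag_lt -pair_eqE /pair_eq /= (leq_eqVlt a.2).
by case: eqP; case: eqP; case: ltnP => //=; lia.
Qed.

Lemma tag_ltNge a b : tag_lt a b = ~~ tag_le b a.
Proof. by rewrite tag_leE /tag_lt; lia. Qed.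

Lemma tag_le_trans b a c : tag_le a b -> tag_le b c -> tag_le a c.
Proof. by rewrite !tag_leE; lia. Qed.

Lemma tag_ltW a b : tag_lt a b -> tag_le a b.
Proof. by rewrite /tag_le => ->; rewrite orbT. Qed.

Lemma tag_le_total a b : tag_le a b || tag_le b a.
Proof. by rewrite !tag_leE; lia. Qed.

Lemma tag_le_anti a b : tag_le a b -> tag_le b a -> a = b.
Proof. by case: a b => [a1 a2] [b1 b2]; rewrite !tag_leE /= => *; congr pair; lia. Qed.

Lemma t0_le t : tag_le t0 t.
Proof. by rewrite tag_leE /=; lia. Qed.

Lemma max_tag_cases s : max_tag s = t0 \/ max_tag s \in s.
Proof.
elim: s => /= [|a s IH]; first by left.
rewrite /tag_max; case: ifP => _; last by right; rewrite mem_head.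
by case: IH => [->|IH]; [left|right; rewrite in_cons IH orbT].
Qed.

(** * Transitions *)

Section Transitions.
Variables (n f e : nat) (V C : Type).
Variable Phi : 'I_n -> V -> C.
Variable Dec : seq ('I_n * C) -> V.

Local Notation proc := (proc n).
Local Notation payload := (payload n V C).
Local Notation out := (out n V C).
Local Notation gstate := (gstate n V C).

(** Message numbers are dropped: the invariants ask only for some copy in transit. *)
Definition in_net (g : gstate) src d p := exists i, List.In (Msg i src d p) (gnet g).

Definition crashS cut (st : sstate n C) :=
  SState (s_tag st) (s_c st) (s_R st) (s_H st) (s_seen st) (s_cnt st)
         (cut_crash cut (s_crashed st)).
Definition crashW cut (st : wstate n V) :=
  WState (w_status st) (w_op st) (cut_crash cut (w_crashed st)).
Definition crashR cut (st : rstate n V C) :=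
  RState (r_status st) (r_op st) (r_val st) (cut_crash cut (r_crashed st)).

(* [tstep g g' a o d]: process [a] moves, sends exactly the messages [o] (already
   truncated if [a] crashes), and consumes the message [d], if any. *)
Inductive tstep (g g' : gstate) : proc -> out -> option (proc * payload) -> Prop :=
| TServer s src p err cut st o u of
    ~~ s_crashed (gS g s) & in_net g src (PS s) p &
    server_recv f e Phi s (gS g s) src p err = (st, o, u) &
    (forall s', gS g' s' = if s' == s then crashS cut st else gS g s') &
    gW g' = gW g & gR g' = gR g :
    tstep g g' (PS s) (cut_out cut o) (Some (src, p))
| TWriteInv w v cut st o of
    ~~ w_crashed (gW g w) & w_status (gW g w) = WIdle n V &
    writer_invoke C (gW g w) v = (st, o) &
    (forall w', gW g' w' = if w' == w then crashW cut st else gW g w') &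
    gS g' = gS g & gR g' = gR g :
    tstep g g' (PW w) (cut_out cut o) None
| TWriter w src p cut st o of
    ~~ w_crashed (gW g w) & in_net g src (PW w) p &
    writer_recv f e w (gW g w) src p = (st, o) &
    (forall w', gW g' w' = if w' == w then crashW cut st else gW g w') &
    gS g' = gS g & gR g' = gR g :
    tstep g g' (PW w) (cut_out cut o) (Some (src, p))
| TReadInv r cut st o of
    ~~ r_crashed (gR g r) & r_status (gR g r) = RIdle n C &
    reader_invoke (gR g r) = (st, o) &
    (forall r', gR g' r' = if r' == r then crashR cut st else gR g r') &
    gS g' = gS g & gW g' = gW g :
    tstep g g' (PR r) (cut_out cut o) None
| TReader r src p cut st o of
    ~~ r_crashed (gR g r) & in_net g src (PR r) p &
    reader_recv f e Dec r (gR g r) src p = (st, o) &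
    (forall r', gR g' r' = if r' == r then crashR cut st else gR g r') &
    gS g' = gS g & gW g' = gW g :
    tstep g g' (PR r) (cut_out cut o) (Some (src, p))
| TQuiet a of
    (forall s, gS g' s = gS g s \/ gS g' s = crashS (Some 0) (gS g s)) &
    (forall w, gW g' w = gW g w \/ gW g' w = crashW (Some 0) (gW g w)) &
    (forall r, gR g' r = gR g r \/ gR g' r = crashR (Some 0) (gR g r)) :
    tstep g g' a [::] None.

(** All that the later sections know of the network. [net_keep] speaks of numbered messages because
    [reliable_channels] promises the disappearance of one particular message. *)
Record net_step (g g' : gstate) (a : proc) (o : out) (d : option (proc * payload)) : Prop := {
  net_sent : forall dst p, List.In (dst, p) o -> in_net g' a dst p;
  net_new : forall src dst p, in_net g' src dst p ->
    in_net g src dst p \/ (src = a /\ List.In (dst, p) o);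
  net_keep : forall m, List.In m (gnet g) ->
    List.In m (gnet g') \/ (mdst m = a /\ d = Some (msrc m, mpay m)) }.

Lemma in_net_keep g g' a o d src dst p : net_step g g' a o d -> in_net g src dst p ->
  in_net g' src dst p \/ (dst = a /\ d = Some (src, p)).
Proof. by move=> ns [i /(net_keep ns)[|]]; [left; exists i|right]. Qed.

(** [remove_msg] filters by number: without unique numbers a delivery could erase other messages as
    well, and the channels would lose them. *)
Definition mids_ok (g : gstate) :=
  (forall m, List.In m (gnet g) -> mid m < gnext g) /\
  (forall m m', List.In m (gnet g) -> List.In m' (gnet g) -> mid m = mid m' -> m = m').

Lemma In_mkmsgs src i (o : out) m : List.In m (mkmsgs src i o) ->
  [/\ msrc m = src, List.In (mdst m, mpay m) o, i <= mid m & mid m < i + size o].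
Proof.
elim: o i => [|[d p] o IH] i //= [<-/=|/IH[-> H1 H2 H3]].
  by split; [|left| |lia].
by split; [|right|lia|lia].
Qed.

Lemma mkmsgs_In src i (o : out) d p : List.In (d, p) o ->
  exists j, List.In (Msg j src d p) (mkmsgs src i o).
Proof.
elim: o i => [|[d' p'] o IH] i //= [[-> ->]|/(IH i.+1)[j Hj]].
  by exists i; left.
by exists j; right.
Qed.

Lemma mkmsgs_inj src i (o : out) m m' : List.In m (mkmsgs src i o) ->
  List.In m' (mkmsgs src i o) -> mid m = mid m' -> m = m'.
Proof.
elim: o i => [|[d p] o IH] i //= [<-|H1] [<-|H2] //=.
- by case/In_mkmsgs: H2 => _ _ /[swap] _ + E; rewrite -E ltnn.
- by case/In_mkmsgs: H1 => _ _ /[swap] _ + E; rewrite E ltnn.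
exact: IH H1 H2.
Qed.

(** [net0] is the old network, possibly without the delivered message, before the new messages are
    appended. *)
Lemma net_step_send (g g' : gstate) a (o : out) d net0 :
  mids_ok g ->
  gnet g' = net0 ++ mkmsgs a (gnext g) o -> gnext g' = gnext g + size o ->
  (forall m, List.In m net0 -> List.In m (gnet g)) ->
  (forall m, List.In m (gnet g) ->
     List.In m net0 \/ (mdst m = a /\ d = Some (msrc m, mpay m))) ->
  net_step g g' a o d /\ mids_ok g'.
Proof.
move=> [lt_mid inj_mid] En Ex sub0 keep0; split; last split.
- split.
  + move=> dst p /(mkmsgs_In a (gnext g))[j Hj].
    by exists j; rewrite En In_cat; right.
  + move=> src dst p [j]; rewrite En In_cat => -[/sub0 H|/In_mkmsgs[/= -> H _ _]].
      by left; exists j.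
    by right.
  + by move=> m /keep0[]; [left; rewrite En In_cat; left|right].
- move=> m; rewrite En Ex In_cat => -[/sub0/lt_mid|/In_mkmsgs[_ _ _ //]]; lia.
move=> m m'; rewrite En !In_cat => -[H1|H1] [H2|H2] E.
- by apply: inj_mid => //; apply: sub0.
- move/sub0/lt_mid: H1; case/In_mkmsgs: H2; lia.
- move/sub0/lt_mid: H2; case/In_mkmsgs: H1; lia.
exact: mkmsgs_inj H1 H2 E.
Qed.

Lemma step_tstep g g' : mids_ok g ->
  step f e Phi Dec g g' \/ g' = g ->
  exists a o d, [/\ tstep g g' a o d, net_step g g' a o d & mids_ok g'].
Proof.
move=> ok [St|->]; last first.
  (* A stutter counts as a quiet step; the acting process [PW 0] is an arbitrary choice. *)
  have [H1 H2] : net_step g g (PW 0) [::] None /\ mids_ok g.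
    by apply: (@net_step_send _ _ _ _ _ (gnet g)); rewrite //= ?cats0 ?addn0; auto.
  exists (PW 0), [::], None; split=> //.
  by apply: TQuiet; left.
case: St ok => {g'} [{}g w v cut al idl|{}g r cut al idl|{}g m err cut inm al|{}g p al] ok.
- case E: (writer_invoke C (gW g w) v) => [st o].
  exists (PW w), (cut_out cut o), None.
  have [||||H1 H2] := @net_step_send g (commitW g w st o cut) (PW w) (cut_out cut o)
     None (gnet g) ok => //; first by left.
  by split=> //; eapply TWriteInv; eauto.
- case E: (reader_invoke (gR g r)) => [st o].
  exists (PR r), (cut_out cut o), None.
  have [||||H1 H2] := @net_step_send g (commitR g r st o cut) (PR r) (cut_out cut o)
     None (gnet g) ok => //; first by left.
  by split=> //; eapply TReadInv; eauto.
- have inn : in_net g (msrc m) (mdst m) (mpay m) by exists (mid m); case: (m) inm.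
  have sub0 m' : List.In m' [seq m' <- gnet g | mid m' != mid m] -> List.In m' (gnet g).
    by rewrite In_filter => -[].
  have keep0 m' : List.In m' (gnet g) ->
      List.In m' [seq m' <- gnet g | mid m' != mid m] \/
      (mdst m' = mdst m /\ Some (msrc m, mpay m) = Some (msrc m', mpay m')).
    move=> H; rewrite In_filter; case: eqP => E; last by left.
    by right; rewrite (ok.2 _ _ H inm E).
  rewrite /deliver; case Ed: (mdst m) al inn sub0 keep0 => [w|r|s] al inn sub0 keep0.
  + case E: (writer_recv f e w _ _ _) => [st o].
    exists (PW w), (cut_out cut o), (Some (msrc m, mpay m)).
    have [||H1 H2] := @net_step_send g (commitW (remove_msg g m) w st o cut) (PW w)
      (cut_out cut o) (Some (msrc m, mpay m)) _ ok _ _ sub0 keep0 => //.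
    by split=> //; eapply TWriter; eauto.
  + case E: (reader_recv f e Dec r _ _ _) => [st o].
    exists (PR r), (cut_out cut o), (Some (msrc m, mpay m)).
    have [||H1 H2] := @net_step_send g (commitR (remove_msg g m) r st o cut) (PR r)
      (cut_out cut o) (Some (msrc m, mpay m)) _ ok _ _ sub0 keep0 => //.
    by split=> //; eapply TReader; eauto.
  + case E: (server_recv f e Phi s _ _ _ _) => [[st o] u].
    exists (PS s), (cut_out cut o), (Some (msrc m, mpay m)).
    have [||H1 H2] := @net_step_send g (commitS (remove_msg g m) s st o cut u) (PS s)
      (cut_out cut o) (Some (msrc m, mpay m)) _ ok _ _ sub0 keep0 => //.
    by split=> //; eapply TServer; eauto.
exists p, [::], None.
have [||||H1 H2] := @net_step_send g (crash g p) p [::] None (gnet g) ok => //.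
- by case: (p); rewrite /= cats0.
- by case: (p); rewrite /= addn0.
- by left.
split=> //; apply: TQuiet; case: (p) => q x /=; rewrite /crashS /crashW /crashR /=;
  by [left | case: eqP => [->|_]; [right|left]].
Qed.

End Transitions.

(** * Histories *)

Section Histories.
Variables (n f e : nat) (V C : Type).

Local Notation proc := (proc n).
Local Notation payload := (payload n V C).
Local Notation out := (out n V C).
Local Notation gstate := (gstate n V C).
Local Notation iid := (iid n).

(* The history: [L src dst p] holds when [p] was ever sent from [src] to [dst]. *)
Definition history := proc -> proc -> payload -> Prop.
Implicit Types (g : gstate) (L : history) (id : iid) (t : Defs.tag).

Definition sub_hist L L' := forall src d p, L src d p -> L' src d p.
Definition add1 L a d p : history :=
  fun src d' p' => L src d' p' \/ [/\ src = a, d' = d & p' = p].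
Definition add_out L a (o : out) : history :=
  fun src d p => L src d p \/ (src = a /\ List.In (d, p) o).

Definition pid (p : payload) : option iid :=
  match p with PVal id _ _ | PCod id _ _ | PMeta id _ => Some id | _ => None end.
Definition pval (p : payload) : option (iid * Defs.tag) :=
  match p with PVal id t _ | PCod id t _ => Some (id, t) | _ => None end.

Definition sent_to L id (s : 'I_n) :=
  exists src p, L src (PS s) p /\ pid p = Some id.
Definition id_tag L id t := exists src d p, L src d p /\ pval p = Some (id, t).

(* The identifier under which [reader_recv] sends READ-VALUE. *)
Definition rv_id (rd : rid) : iid := (PR rd.1, 2 * rd.2).

(** Operation numbers grow only at invocations, which require an idle reader, so a smaller number
    belongs to a read that is over. *)
Definition finished g (rd : rid) :=
  rd.2 < r_op (gR g rd.1) \/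
  (r_op (gR g rd.1) = rd.2 /\ r_status (gR g rd.1) = RIdle n C).
(** The tag is recorded so that a registration found at a server can be identified with the tag held
    by the reader. *)
Definition collecting g (rd : rid) tr :=
  finished g rd \/ exists pairs, r_status (gR g rd.1) = RColl rd.2 tr pairs.
(* The identifier [(PW w, op)] may already be in use. *)
Definition past_query g w op :=
  op < w_op (gW g w) \/
  (op = w_op (gW g w) /\ forall op' v reps, w_status (gW g w) <> WQuery op' v reps).

(** The first disjunct accounts for the entry [(t0, s, rd)] that an early READ-COMPLETE puts into
    the log although [s] may have sent no element. *)
Definition data_sent g L s t (rd : rid) :=
  finished g rd \/ exists c, L (PS s) (PR rd.1) (PData rd t c).
(** What entitles a server to forget a reader. For positive [k], [n - f] equals [k + 2 * e], the
    number of elements of one tag that ends the read. *)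
Definition enough g L rd := exists t (S : seq 'I_n),
  [/\ uniq S, n - f <= size S & forall s, s \in S -> data_sent g L s t rd].

(* Tags reported to clients: the value carrying the tag will reach every server. *)
Definition spread L t :=
  t = t0 \/ exists2 id, id_tag L id t & forall x : 'I_n, x < f.+1 -> sent_to L id x.

(* Every sender addresses the relays [s_1, ..., s_(f+1)] in increasing order, so an
   invocation reaching a server has been sent to all lower relays, even if its
   sender crashed midway. *)
Definition lower_sent L id (s : 'I_n) :=
  forall q : 'I_n, q < s -> q < f.+1 -> sent_to L id q.

(** The identifier reveals the kind of the message: even and odd counters of a reader for READ-VALUE
    and READ-COMPLETE, a server for READ-DISPERSE. Since values come from writers, no identifier
    stands for two kinds of message. *)
Definition meta_ok g L id (m : meta n) :=
  match m with
  | RV rd tr => id = rv_id rd /\ collecting g rd tr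
  | RC rd tr => id = (PR rd.1, (2 * rd.2).+1) /\ finished g rd
  | RD t s rd => (exists s', id.1 = PS s') /\ data_sent g L s t rd
  end.

(** For an element, the clause on [rv_id rd] separates a genuine element of tag [t0] from the mark
    of an early READ-COMPLETE: a server that has not seen READ-VALUE can have logged only the mark
    for itself. *)
Definition msg_ok g L src d (p : payload) : Prop :=
  match p with
  | PQuery _ | PAck _ => True
  | PRTag op t => spread L t
  | PVal id t v => (exists s : 'I_n, [/\ d = PS s, s < f.+1 & lower_sent L id s]) /\
      exists2 w, id.1 = PW w & past_query g w id.2
  | PCod id t c => (exists s : 'I_n, [/\ d = PS s, f < s & lower_sent L id s]) /\
      exists2 w, id.1 = PW w & past_query g w id.2
  | PMeta id m => (exists2 s : 'I_n, d = PS s & lower_sent L id s) /\ meta_ok g L id m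
  | PData rd t c => exists s,
      [/\ src = PS s, d = PR rd.1, rv_id rd \in s_seen (gS g s) &
          exists tr, collecting g rd tr]
  end.

Record state_le g g' : Prop := {
  le_seen : forall s id, id \in s_seen (gS g s) -> id \in s_seen (gS g' s);
  le_finished : forall rd, finished g rd -> finished g' rd;
  le_collecting : forall rd tr, collecting g rd tr -> collecting g' rd tr;
  le_past_query : forall w op, past_query g w op -> past_query g' w op;
  le_crashed : forall p, crashed g p -> crashed g' p }.

Lemma state_le_refl g : state_le g g.
Proof. by []. Qed.

Lemma sub_hist_refl L : sub_hist L L. Proof. by []. Qed.

Lemma sent_to_mono L L' id s : sub_hist L L' -> sent_to L id s -> sent_to L' id s.
Proof. by move=> sub [src [p [/sub H E]]]; exists src, p. Qed.

Lemma id_tag_mono L L' id t : sub_hist L L' -> id_tag L id t -> id_tag L' id t.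
Proof. by move=> sub [src [d [p [/sub H E]]]]; exists src, d, p. Qed.

Lemma data_sent_mono g L g' L' s t rd : state_le g g' -> sub_hist L L' ->
  data_sent g L s t rd -> data_sent g' L' s t rd.
Proof. by move=> le sub [/(le_finished le)|[c /sub]]; [left|right; exists c]. Qed.

Lemma enough_mono g L g' L' rd : state_le g g' -> sub_hist L L' ->
  enough g L rd -> enough g' L' rd.
Proof.
move=> le sub [t [S [uS sS dS]]]; exists t, S; split=> // s /dS.
exact: data_sent_mono.
Qed.

Lemma finished_enough g L rd : finished g rd -> enough g L rd.
Proof.
move=> fin; exists t0, (enum 'I_n); rewrite enum_uniq size_enum_ord leq_subr.
by split=> // s _; left.
Qed.

Lemma spread_mono L L' t : sub_hist L L' -> spread L t -> spread L' t.
Proof.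
move=> sub [|[id /(id_tag_mono sub) H1 H2]]; first by left.
by right; exists id => // x /H2; apply: sent_to_mono.
Qed.

Lemma lower_sent_mono L L' id s : sub_hist L L' -> lower_sent L id s -> lower_sent L' id s.
Proof. by move=> sub H q /H{}H /H; apply: sent_to_mono. Qed.

Lemma msg_ok_mono g L g' L' src d p : state_le g g' -> sub_hist L L' ->
  msg_ok g L src d p -> msg_ok g' L' src d p.
Proof.
move=> le sub; case: p => //=.
- by move=> _ t; apply: spread_mono.
- move=> id t _ [[s [-> ss cl]] [w ew /(le_past_query le) pq]].
  by split; [exists s; split=> //; apply: lower_sent_mono cl|exists w].
- move=> id t _ [[s [-> ss cl]] [w ew /(le_past_query le) pq]].
  by split; [exists s; split=> //; apply: lower_sent_mono cl|exists w].
- move=> id m [[s -> cl] ok]; split; first by exists s => //; apply: lower_sent_mono cl.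
  case: m ok => [rd tr|rd tr|t s' rd] /= [H1 H2]; split=> //.
  + exact: le_collecting H2.
  + exact: le_finished H2.
  exact: data_sent_mono H2.
move=> rd t _ [s [-> -> /(le_seen le) sn [tr /(le_collecting le) co]]].
by exists s; split=> //; exists tr.
Qed.

(* Messages are checked one at a time, each against the ones before it, so that the
   property survives truncation of the output by a crash. *)
Fixpoint sends_ok g L a (o : out) : Prop :=
  if o is (d, p) :: o' then msg_ok g L a d p /\ sends_ok g (add1 L a d p) a o'
  else True.

Lemma sub_add1 L a d p : sub_hist L (add1 L a d p). Proof. by left. Qed.

Lemma add1_mono L L' a d p : sub_hist L L' -> sub_hist (add1 L a d p) (add1 L' a d p).
Proof. by move=> sub src d' p' [/sub|]; [left|right]. Qed.

Lemma sub_add_out L a o : sub_hist L (add_out L a o). Proof. by left. Qed.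

Lemma sends_ok_mono g L L' a o : sub_hist L L' -> sends_ok g L a o -> sends_ok g L' a o.
Proof.
elim: o L L' => [|[d p] o IH] L L' //= sub [ok oks]; split.
  exact: msg_ok_mono (state_le_refl g) sub ok.
by apply: IH oks; apply: add1_mono.
Qed.

Lemma sends_ok_cat g L a o1 o2 : sends_ok g L a o1 -> sends_ok g (add_out L a o1) a o2 ->
  sends_ok g L a (o1 ++ o2).
Proof.
elim: o1 L => [|[d p] o1 IH] L /=.
  by move=> _; apply: sends_ok_mono => src d p [|[]].
move=> [ok oks] H; split=> //; apply: IH => //; apply: sends_ok_mono H.
by move=> src d' p' [H|[-> [[<- <-]|H]]]; [left; left|left; right|right].
Qed.

Lemma sends_ok_take g L a o j : sends_ok g L a o -> sends_ok g L a (take j o).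
Proof. by elim: o L j => [|[d p] o IH] L [|j] //= [ok /IH]. Qed.

Lemma sends_ok_all g L a o : sends_ok g L a o ->
  forall d p, List.In (d, p) o -> msg_ok g (add_out L a o) a d p.
Proof.
elim: o L => [|[d p] o IH] L //= [ok oks] d' p' [[<- <-]|H].
  by apply: msg_ok_mono ok; [apply: state_le_refl|left].
apply: msg_ok_mono (IH _ oks _ _ H); first exact: state_le_refl.
move=> src d1 p1 [[H1|[-> -> ->]]|[-> H1]]; first by left.
  by right; split=> //; left.
by right; split=> //; right.
Qed.

(** The history [L'] varies because each copy is checked after the copies that precede it. *)
Definition relay_ok g L a id (fp : 'I_n -> payload) (l : seq 'I_n) :=
  forall x L', x \in l -> sub_hist L L' -> lower_sent L' id x -> msg_ok g L' a (PS x) (fp x).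

(** A relay below the recipient [x] was addressed earlier or stands in [l]. In the second case
    sortedness places it before [x], so its copy is already in the history when the one to [x] is
    checked. *)
Lemma bcast_ok g L a id fp (l : seq 'I_n) :
  (forall x, pid (fp x) = Some id) ->
  sorted ltn (map val l) ->
  (forall x q : 'I_n, x \in l -> q < x -> q < f.+1 -> sent_to L id q \/ q \in l) ->
  relay_ok g L a id fp l ->
  sends_ok g L a [seq (PS x, fp x) | x <- l].
Proof.
move=> idfp; elim: l L => [|x l IH] L //= srt cov rel.
have lt_x y : y \in l -> x < y.
  move: srt; rewrite (path_sortedE ltn_trans) => /andP[/allP H _] yl.
  by apply: H; apply: map_f.
split.
  apply: rel; [exact: mem_head|exact: sub_hist_refl|].
  move=> q qx qf; case: (cov x q (mem_head _ _) qx qf) => // {cov}.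
  by rewrite in_cons => /orP[/eqP E|/lt_x]; [rewrite E ltnn in qx|lia].
apply: IH.
- by rewrite (path_sorted srt).
- move=> y q yl qy qf.
  case: (cov y q _ qy qf); rewrite ?in_cons ?yl ?orbT //.
    by move=> H; left; apply: sent_to_mono H; apply: sub_add1.
  case/orP=> [/eqP ->|]; last by right.
  by left; exists a, (fp x); split=> //; right.
move=> y L' yl sub; apply: rel; first by rewrite in_cons yl orbT.
by move=> src d p H; apply: sub; left.
Qed.

Lemma sorted_filter_ord (P : pred 'I_n) : sorted ltn (map val (filter P (enum 'I_n))).
Proof.
rewrite sorted_map; apply: sorted_filter; first by move=> x y z; apply: ltn_trans.
by have := iota_ltn_sorted 0 n; rewrite -val_enum_ord sorted_map.
Qed.

Lemma mem_prims (s : 'I_n) : (s \in prims n f) = (s < f.+1).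
Proof. by rewrite mem_filter mem_enum andbT. Qed.

Lemma mem_fwd (s x : 'I_n) : (x \in fwd f s) = (s < x) && (x < f.+1).
Proof. by rewrite mem_filter mem_enum andbT. Qed.

Lemma mem_nonprims (x : 'I_n) : (x \in nonprims n f) = (f < x).
Proof. by rewrite mem_filter mem_enum andbT. Qed.

Lemma prims_bcast_ok g L a id fp :
  (forall x, pid (fp x) = Some id) -> relay_ok g L a id fp (prims n f) ->
  sends_ok g L a [seq (PS x, fp x) | x <- prims n f].
Proof.
move=> idfp rel; apply: (bcast_ok (id := id)) => //; first exact: sorted_filter_ord.
by move=> x q _ _ qf; right; rewrite mem_prims.
Qed.

Lemma md_meta_ok g L a c m : meta_ok g L (a, c) m ->
  sends_ok g L a (md_meta f V C a c m).
Proof.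
move=> ok; apply: (prims_bcast_ok (id := (a, c)) (fp := fun=> PMeta (a, c) m)) => //.
move=> x L' xp sub cl /=; split; first by exists x.
case: m ok => [rd tr|rd tr|t s' rd] //= [H1 H2]; split=> //.
exact: data_sent_mono (state_le_refl g) sub H2.
Qed.

Definition relays (s : 'I_n) (fp : 'I_n -> payload) : out :=
  if s < f.+1 then [seq (PS x, fp x) | x <- fwd f s] ++ [seq (PS x, fp x) | x <- nonprims n f]
  else [::].

(** The sender has its own copy, the relays below it were addressed before it, and [fwd] serves the
    relays above it in order; when the turn of the other servers comes, every relay is covered. *)
Lemma relays_ok g L (s : 'I_n) id fp :
  (forall x, pid (fp x) = Some id) -> sent_to L id s -> lower_sent L id s ->
  (forall (x : 'I_n) L', s < x -> sub_hist L L' -> lower_sent L' id x ->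
     msg_ok g L' (PS s) (PS x) (fp x)) ->
  sends_ok g L (PS s) (relays s fp).
Proof.
rewrite /relays => idfp sts cl rel; case: ifP => // sf.
have cov (q : 'I_n) : q < f.+1 -> sent_to L id q \/ q \in fwd f s.
  move=> qf; rewrite mem_fwd qf andbT; case: (ltngtP q s) => [qs|sq|E].
  - by left; apply: cl.
  - by right.
  by left; rewrite (_ : q = s) //; apply: val_inj.
apply: sends_ok_cat.
  apply: (bcast_ok (id := id)) => //; first exact: sorted_filter_ord.
    by move=> x q _ _ /cov.
  by move=> x L'; rewrite mem_fwd => /andP[sx _]; apply: rel.
apply: (bcast_ok (id := id)) => //; first exact: sorted_filter_ord.
  move=> x q _ _ /cov[H|qf]; left; first by apply: sent_to_mono H; apply: sub_add_out.
  exists (PS s), (fp q); split=> //; right; split=> //.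
  by apply/In_map; exists q => //; apply/In_mem.
move=> x L'; rewrite mem_nonprims => fx sub; apply: rel; first by lia.
by move=> src d p H; apply: sub; left.
Qed.

Lemma In_relays (s : 'I_n) fp (x : 'I_n) : s < f.+1 -> s < x -> List.In (PS x, fp x) (relays
    s fp).
Proof.
rewrite /relays => -> sx; rewrite In_cat; case: (ltnP f x) => fx; [right|left];
  by apply/In_map; exists x => //; apply/In_mem; rewrite ?mem_fwd ?mem_nonprims ?sx.
Qed.

Lemma relays_inv (s : 'I_n) fp d p : List.In (d, p) (relays s fp) ->
  exists x : 'I_n, [/\ d = PS x, p = fp x & s < x].
Proof.
rewrite /relays; case: ifP => // sf; rewrite In_cat !In_map => -[[x Hx [-> ->]]|[x Hx [->
    ->]]];
  exists x; split=> //; move/In_mem: Hx; rewrite ?mem_fwd ?mem_nonprims; lia.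
Qed.

End Histories.

(** * Server handlers *)

Section ServerStep.
Variables (n f e : nat) (V C : Type).
Variable Phi : 'I_n -> V -> C.
Variable v0 : V.

Local Notation proc := (proc n).
Local Notation payload := (payload n V C).
Local Notation out := (out n V C).
Local Notation gstate := (gstate n V C).
Local Notation sstate := (sstate n C).
Local Notation iid := (iid n).
Local Notation history := (history n V C).
Implicit Types (g : gstate) (L : history) (id : iid) (t : Defs.tag) (s : 'I_n).

(** The output of the fold in [value_deliver], in recursive form: the message-by-message check is an
    induction from the front, whereas the fold appends at the back. *)
Fixpoint data_blocks s tw c cnt (regs : seq (rid * Defs.tag)) : out :=
  if regs is x :: regs' then
    (PR x.1.1, PData x.1 tw c) :: md_meta f V C (PS s) cnt (RD tw s x.1)
      ++ data_blocks s tw c cnt.+1 regs'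
  else [::].

Definition addHs tw s := foldl (fun H (x : rid * Defs.tag) => addH (tw, s, x.1) H).

Lemma value_deliverE s (st : sstate) tw c :
  let regs := [seq x <- s_R st | tag_le x.2 tw] in
  let new := tag_lt (s_tag st) tw in
  value_deliver f V s st tw c =
  (SState (if new then tw else s_tag st) (if new then c else s_c st) (s_R st)
     (addHs tw s (s_H st) regs) (s_seen st) (s_cnt st + size regs) (s_crashed st),
   rcons (data_blocks s tw c (s_cnt st) regs) (PW tw.2, PAck tw)).
Proof.
rewrite /value_deliver.
set F := (X in foldl X); set regs := filter _ _.
have E H cnt o : foldl F (H, cnt, o) regs =
    (addHs tw s H regs, cnt + size regs, o ++ data_blocks s tw c cnt regs).
  elim: regs H cnt o => [|x regs IH] H cnt o /=; first by rewrite addn0 cats0.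
  by rewrite IH addSnnS -catA.
by rewrite E cat0s; case: ifP.
Qed.

Lemma mem_addH x y H : (x \in @addH n y H) = (x == y) || (x \in H).
Proof.
rewrite /addH; case: ifP => yH; last by rewrite mem_rcons in_cons.
by case: eqP => // ->.
Qed.

Lemma addH_uniq x H : uniq H -> uniq (@addH n x H).
Proof. by rewrite /addH; case: ifP => // xH; rewrite rcons_uniq xH. Qed.

Lemma addHs_uniq tw s H regs : uniq H -> uniq (addHs tw s H regs).
Proof. by elim: regs H => //= x regs IH H /(addH_uniq (tw, s, x.1))/IH. Qed.

Lemma mem_addHs tw s H regs x : x \in addHs tw s H regs ->
  x \in H \/ exists2 y, y \in regs & x = (tw, s, y.1).
Proof.
elim: regs H => [|y regs IH] H /=; first by left.
case/IH => [|[z zr ->]]; last by right; exists z => //; rewrite in_cons zr orbT.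
rewrite mem_addH => /orP[/eqP ->|]; last by left.
by right; exists y => //; apply: mem_head.
Qed.

Lemma In_data_blocks s tw c cnt regs y : y \in regs ->
  List.In (PR y.1.1, PData y.1 tw c) (data_blocks s tw c cnt regs).
Proof.
elim: regs cnt => //= x regs IH cnt; rewrite in_cons => /orP[/eqP ->|/IH H]; first by left.
by right; apply/In_cat; right.
Qed.

Lemma md_meta_pval (a : proc) c m d p : List.In (d, p) (md_meta f V C a c m) -> pval p = None.
Proof. by case/In_map => x _ [_ ->]. Qed.

Lemma data_blocks_pval s tw c cnt regs d p :
  List.In (d, p) (data_blocks s tw c cnt regs) -> pval p = None.
Proof.
elim: regs cnt => //= x regs IH cnt [[_ <-] //|/In_cat[/md_meta_pval //|/IH //]].
Qed.

(** The element comes before its READ-DISPERSE in program order, so a crash cannot leave an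
    announcement without the element. *)
Lemma data_block_ok g L s t c cnt rd tr :
  rv_id n rd \in s_seen (gS g s) -> collecting g rd tr ->
  sends_ok f g L (PS s) ((PR rd.1, PData rd t c) :: md_meta f V C (PS s) cnt (RD t s rd)).
Proof.
move=> sn co; split; first by exists s; split=> //; exists tr.
by apply: md_meta_ok; split; [exists s|right; exists c; right].
Qed.

Lemma data_blocks_ok g L s tw c cnt regs :
  (forall y, y \in regs -> rv_id n y.1 \in s_seen (gS g s) /\ exists tr, collecting g y.1
      tr) ->
  sends_ok f g L (PS s) (data_blocks s tw c cnt regs).
Proof.
elim: regs L cnt => // x regs IH L cnt H.
have [sn [tr co]] := H x (mem_head _ _).
rewrite [data_blocks _ _ _ _ _]/=.
apply: (@sends_ok_cat _ _ _ _ _ _ _ (_ :: _)); first exact: data_block_ok sn co.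
by apply: IH => y yr; apply: H; rewrite in_cons yr orbT.
Qed.

Lemma meta_deliver_fields s (st : sstate) m err st' o b :
  meta_deliver f e V s st m err = (st', o, b) ->
  [/\ s_tag st' = s_tag st, s_seen st' = s_seen st & s_crashed st' = s_crashed st].
Proof.
by case: st => t c R H seen cnt cr; case: m => [rd tr|rd tr|t1 s1 rd] /=;
  do ?case: ifP => // _; case=> <- _ _.
Qed.

Lemma meta_deliver_pval s (st : sstate) m err st' o b d p :
  meta_deliver f e V s st m err = (st', o, b) -> List.In (d, p) o -> pval p = None.
Proof.
case: st => t c R H seen cnt cr; case: m => [rd tr|rd tr|t1 s1 rd] /=;
  do ?case: ifP => _; case=> _ <- _ //=; by case=> [[_ <-]|/md_meta_pval].
Qed.

(** A server drops a full value outside the relays, and a coded element at a relay, without marking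
    the identifier as seen. [msg_ok] guarantees that no such message is ever sent. *)
Definition addressed (p : payload) s :=
  match p with PVal _ _ _ => s < f.+1 | PCod _ _ _ => f < s | _ => true end.

(* In [CaseValue] the value [v] is arbitrary when [s] is not a relay. *)
Inductive recv_case s (st : sstate) (src : proc) (p : payload) : sstate -> out -> Prop :=
| CaseQuery op of p = PQuery op :
    recv_case s st src p st [:: (src, PRTag op (s_tag st))]
| CaseIgnore of (forall id, pid p = Some id -> addressed p s -> id \in s_seen st) &
    (forall op, p <> PQuery op) :
    recv_case s st src p st [::]
| CaseValue id t c v st' o of
    pval p = Some (id, t) & pid p = Some id & id \notin s_seen st &
    value_deliver f V s (mark_seen st id) t c = (st', o) :
    recv_case s st src p st'
      (relays f s (fun x => if x < f.+1 then PVal id t v else PCod id t (Phi x v)) ++ o)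
| CaseMeta id m err st' o b of
    p = PMeta id m & id \notin s_seen st &
    meta_deliver f e V s (mark_seen st id) m err = (st', o, b) :
    recv_case s st src p st' (relays f s (fun=> PMeta id m) ++ o).

Lemma server_recvP s st src p err st' o u :
  server_recv f e Phi s st src p err = (st', o, u) -> recv_case s st src p st' o.
Proof.
case: p => [op|op t|id t v|id t c|t|id m|rd t c]; rewrite /server_recv.
- by case=> <- <- _; apply: CaseQuery.
- by case=> <- <- _; apply: CaseIgnore.
- case: ifP => [/andP[sf nid]|nsf].
    case E: (value_deliver _ _ _ _ _ _) => [st2 o2] [<- <- _].
    have -> : [seq (PS s', PVal id t v) | s' <- fwd f s] ++
        [seq (PS s', PCod id t (Phi s' v)) | s' <- nonprims n f] =
        relays f s (fun x => if x < f.+1 then PVal id t v else PCod id t (Phi x v)).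
      rewrite /relays sf; congr cat; apply/eq_in_map => x.
        by rewrite mem_fwd => /andP[_ ->].
      by rewrite mem_nonprims => fx; rewrite ltnNge fx.
    exact: CaseValue E.
  case=> <- <- _; apply: CaseIgnore => // id' [<-] /= sf.
  by rewrite sf /= in nsf; move/negbFE: nsf.
- case: ifP => [/andP[sf nid]|nsf].
    case E: (value_deliver _ _ _ _ _ _) => [st2 o2] [<- <- _].
    rewrite -[o2]cat0s.
    have -> : [::] = relays f s (fun x => if x < f.+1 then PVal id t v0 else PCod id t (Phi
        x v0)).
      by rewrite /relays ltnNge sf.
    exact: CaseValue E.
  case=> <- <- _; apply: CaseIgnore => // id' [<-] /= sf.
  by rewrite sf /= in nsf; move/negbFE: nsf.
- by case=> <- <- _; apply: CaseIgnore.
- case: ifP => [nid|nsf].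
    case E: (meta_deliver _ _ _ _ _ _ _) => [[st2 o2] b] [<- <- _].
    exact: CaseMeta E.
  by case=> <- <- _; apply: CaseIgnore => // id' [<-] _; move/negbFE: nsf.
by case=> <- <- _; apply: CaseIgnore.
Qed.

Lemma recv_case_seen s st src p st' o id : recv_case s st src p st' o ->
  pid p = Some id -> addressed p s -> id \in s_seen st'.
Proof.
case=> [op -> //|H _ pi ad|id' t c v st2 o2 _ -> nid|id' m err st2 o2 b -> nid].
- exact: H.
- by rewrite value_deliverE => -[<- _] [<-] _; apply: mem_head.
by case/meta_deliver_fields => _ -> _ [<-] _; apply: mem_head.
Qed.

Lemma recv_case_seen_inv s st src p st' o id : recv_case s st src p st' o ->
  id \in s_seen st' -> id \in s_seen st \/ pid p = Some id.
Proof.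
case=> [op _|_ _|id' t c v st2 o2 _ -> nid|id' m err st2 o2 b -> nid]; [by left|by left| |].
- by rewrite value_deliverE => -[<- _]; rewrite in_cons => /orP[/eqP ->|]; [right|left].
case/meta_deliver_fields => _ -> _; rewrite in_cons => /orP[/eqP ->|]; [by right|by left].
Qed.

Lemma recv_case_mono s st src p st' o : recv_case s st src p st' o ->
  [/\ forall id, id \in s_seen st -> id \in s_seen st',
      tag_le (s_tag st) (s_tag st') & s_crashed st' = s_crashed st].
Proof.
case=> [op _|_ _|id t c v st2 o2 _ _ _|id m err st2 o2 b _ _].
- by split=> //; apply: tag_le_refl.
- by split=> //; apply: tag_le_refl.
- rewrite value_deliverE => -[<- _] /=; split=> //.
    by move=> id'; rewrite in_cons orbC => ->.
  by case: ifP => [/tag_ltW|_] //; apply: tag_le_refl.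
case/meta_deliver_fields => -> -> -> /=; split=> //; last exact: tag_le_refl.
by move=> id'; rewrite in_cons orbC => ->.
Qed.

(** [s_R] is described up to membership because a registration may find its pair already present. *)
Inductive meta_case s (st st' : sstate) : meta n -> out -> Prop :=
| MetaDrop rd tr of (t0, s, rd) \in s_H st & s_R st' = s_R st & s_H st' = remH rd (s_H st) :
    meta_case s st st' (RV rd tr) [::]
| MetaSend rd tr c cnt of (t0, s, rd) \notin s_H st & s_R st' =i (rd, tr) :: s_R st
    & s_H st' = addH (s_tag st, s, rd) (s_H st) :
    meta_case s st st' (RV rd tr)
      ((PR rd.1, PData rd (s_tag st) c) :: md_meta f V C (PS s) cnt (RD (s_tag st) s rd))
| MetaReg rd tr of (t0, s, rd) \notin s_H st & s_R st' =i (rd, tr) :: s_R st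
    & s_H st' = s_H st & ~~ tag_le tr (s_tag st) :
    meta_case s st st' (RV rd tr) [::]
| MetaUnreg rd tr of s_R st' = remR rd (s_R st) & s_H st' = remH rd (s_H st) :
    meta_case s st st' (RC rd tr) [::]
| MetaEarly rd tr of s_R st' = s_R st & s_H st' = addH (t0, s, rd) (s_H st) :
    meta_case s st st' (RC rd tr) [::]
| MetaDone t s' rd of s_R st' = remR rd (s_R st)
    & k n f e + 2 * e <= count (fun x => (x.1.1 == t) && (x.2 == rd)) (addH (t, s', rd) (s_H
        st))
    & s_H st' = remH rd (addH (t, s', rd) (s_H st)) :
    meta_case s st st' (RD t s' rd) [::]
| MetaLog t s' rd of s_R st' = s_R st & s_H st' = addH (t, s', rd) (s_H st) :
    meta_case s st st' (RD t s' rd) [::].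

Lemma meta_deliverP s (st : sstate) m err st' o b :
  meta_deliver f e V s st m err = (st', o, b) -> meta_case s st st' m o.
Proof.
case: st => t c R H seen cnt cr; case: m => [rd tr|rd tr|t1 s1 rd] /=.
- case: ifP => inH; first by case=> <- <- _; apply: MetaDrop.
  have RE : (if (rd, tr) \in R then R else rcons R (rd, tr)) =i (rd, tr) :: R.
    move=> x; rewrite in_cons; case: ifP => inR; last by rewrite mem_rcons in_cons.
    by case: eqP => // ->.
  case: ifP => le [<- <- _]; first by eapply MetaSend => //=; apply/negbT.
  by apply: MetaReg => //=; apply/negbT.
- by case: ifP => _ [<- <- _]; [apply: MetaUnreg|apply: MetaEarly].
by case: ifP => [/andP[_ H1]|_] [<- <- _]; [apply: MetaDone|apply: MetaLog].
Qed.

Lemma recv_case_relays s st src p st' o id : recv_case s st src p st' o ->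
  id \in s_seen st' -> id \in s_seen st \/
  exists fp o2, o = relays f s fp ++ o2 /\ forall x, pid (fp x) = Some id.
Proof.
case=> [op _|_ _|id' t c v st2 o2 _ _ nid|id' m err st2 o2 b _ nid]; [by left|by left| |].
- rewrite value_deliverE => -[<- _]; rewrite in_cons => /orP[/eqP ->|]; last by left.
  by right; eexists; exists o2; split; [reflexivity|move=> x /=; case: ifP].
case/meta_deliver_fields => _ -> _; rewrite in_cons => /orP[/eqP ->|]; last by left.
by right; eexists; exists o2; split; [reflexivity|].
Qed.

Lemma recv_caseE s st src p st' o : recv_case s st src p st' o ->
  [\/ st' = st /\ (forall op, p = PQuery op -> o = [:: (src, PRTag op (s_tag st))]),
      exists id t c fp o2, [/\ pid p = Some id, pval p = Some (id, t), o = relays f s fp ++ o2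
        & value_deliver f V s (mark_seen st id) t c = (st', o2)]
    | exists id m fp o2, [/\ p = PMeta id m /\ id \notin s_seen st, o = relays f s fp ++ o2,
        s_tag st' = s_tag st, s_seen st' = id :: s_seen st
        & meta_case s (mark_seen st id) st' m o2]].
Proof.
case=> [op ->|_ H|id t c v st2 o2 pv pi nid E|id m err st2 o2 b -> nid E].
- by apply: Or31; split=> // op' [->].
- by apply: Or31; split=> // op' /H.
- by apply: Or32; exists id, t, c, (fun x : 'I_n => if x < f.+1 then PVal id t v else PCod
    id t (Phi x v)), o2.
apply: Or33; exists id, m, (fun=> PMeta id m), o2; split=> //.
- by case: (meta_deliver_fields E).
- by case: (meta_deliver_fields E).
exact: meta_deliverP E.
Qed.

End ServerStep.

(** * The invariant *)

Section Invariant.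
Variables (n f e : nat) (V C : Type).
Variable Phi : 'I_n -> V -> C.

Local Notation proc := (proc n).
Local Notation payload := (payload n V C).
Local Notation out := (out n V C).
Local Notation gstate := (gstate n V C).
Local Notation sstate := (sstate n C).
Local Notation iid := (iid n).
Local Notation history := (history n V C).
Implicit Types (g : gstate) (L : history) (id : iid) (t : Defs.tag) (s : 'I_n).

(** [si_relay], [si_H], [si_reg] and [si_data] are restricted to a server that has not crashed:
    after a crash in mid-step the state records sends that were cut off. [si_uniq] turns a number of
    triples with one tag and one reader into a number of distinct servers. *)
Record server_inv g L s : Prop := {
  si_to : forall id, id \in s_seen (gS g s) -> sent_to L id s;
  si_relay : ~~ s_crashed (gS g s) -> forall id (x : 'I_n),
    id \in s_seen (gS g s) -> s < f.+1 -> s < x -> sent_to L id x;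
  si_tag : forall id t, id \in s_seen (gS g s) -> id_tag L id t -> tag_le t (s_tag (gS g s));
  si_orig : s_tag (gS g s) = t0 \/
    exists2 id, id \in s_seen (gS g s) & id_tag L id (s_tag (gS g s));
  si_uniq : uniq (s_H (gS g s));
  si_R : forall rd tr, (rd, tr) \in s_R (gS g s) ->
    rv_id n rd \in s_seen (gS g s) /\ collecting g rd tr;
  si_H : ~~ s_crashed (gS g s) -> forall t s' rd,
    (t, s', rd) \in s_H (gS g s) -> data_sent g L s' t rd;
  si_reg : ~~ s_crashed (gS g s) -> forall rd, rv_id n rd \in s_seen (gS g s) ->
    (exists tr, (rd, tr) \in s_R (gS g s)) \/ enough f g L rd;
  si_data : ~~ s_crashed (gS g s) -> forall rd tr, (rd, tr) \in s_R (gS g s) ->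
    tag_le tr (s_tag (gS g s)) -> data_sent g L s (s_tag (gS g s)) rd }.

Definition query_pending g (c : proc) op (reps : seq ('I_n * Defs.tag)) s :=
  [\/ s \in unzip1 reps, exists t, in_net g (PS s) c (PRTag op t)
    | in_net g c (PS s) (PQuery op)].

Definition collected (pairs : seq ('I_n * Defs.tag * C)) s t :=
  has (fun x => (x.1.1 == s) && (x.1.2 == t)) pairs.

(** The element in transit is allowed to differ from the one in the history, since the reader keeps
    one element per server and tag. The bound on the pairs of each tag is what a read that hangs
    will violate. *)
Definition reader_inv g L r :=
  match r_status (gR g r) with
  | RIdle => True
  | RQuery op reps =>
      [/\ op = r_op (gR g r), 2 * size reps <= n,
          forall x, x \in reps -> spread f L x.2
        & ~~ r_crashed (gR g r) -> forall s, ~~ s_crashed (gS g s) ->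
            query_pending g (PR r) op reps s]
  | RColl op tr pairs =>
      [/\ op = r_op (gR g r), spread f L tr,
          forall t, size [seq x <- pairs | x.1.2 == t] < k n f e + 2 * e,
          forall s t c, L (PS s) (PR r) (PData (r, op) t c) ->
            collected pairs s t \/
            exists c', in_net g (PS s) (PR r) (PData (r, op) t c')
        & ~~ r_crashed (gR g r) -> forall x : 'I_n, x < f.+1 ->
            sent_to L (rv_id n (r, op)) x]
  end.

(* Acknowledgments are tracked through the identifier of the write: since [k] servers
   need not meet a majority, a writer may use the same tag in two writes. *)
Definition writer_inv g L w :=
  match w_status (gW g w) with
  | WIdle => True
  | WQuery op v reps =>
      [/\ op = w_op (gW g w), 2 * size reps <= n
        & ~~ w_crashed (gW g w) -> forall s, ~~ s_crashed (gS g s) ->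
            query_pending g (PW w) op reps s]
  | WAck tw acks =>
      [/\ tw.2 = w, size acks < k n f e,
          ~~ w_crashed (gW g w) -> forall x : 'I_n, x < f.+1 ->
            sent_to L (PW w, w_op (gW g w)) x,
          forall t, id_tag L (PW w, w_op (gW g w)) t -> t = tw
        & forall s, ~~ s_crashed (gS g s) -> (PW w, w_op (gW g w)) \in s_seen (gS g s) ->
            s \in acks \/ in_net g (PS s) (PW w) (PAck tw)]
  end.

(** [inv_pend] speaks of identifiers and not of messages: a server acts on the first copy and drops
    the others, so any copy still in transit will do. *)
Record soda_inv g L : Prop := {
  inv_net : forall src d p, in_net g src d p -> L src d p;
  inv_msg : forall src d p, L src d p -> msg_ok f g L src d p;
  inv_pend : forall src s p id, L src (PS s) p -> pid p = Some id ->
    id \in s_seen (gS g s) \/ exists src' p', in_net g src' (PS s) p' /\ pid p' = Some id;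
  inv_tag : forall id t t', id_tag L id t -> id_tag L id t' -> t = t';
  inv_S : forall s, server_inv g L s;
  inv_R : forall r, reader_inv g L r;
  inv_W : forall w, writer_inv g L w }.

Lemma msg_ok_addressed g L src s (p : payload) : msg_ok f g L src (PS s) p -> addressed f p s.
Proof. by case: p => //= id t v [[s' [[<-] -> _]]]. Qed.

Lemma msg_ok_lower_sent g L src s (p : payload) id : msg_ok f g L src (PS s) p ->
  pid p = Some id -> lower_sent f L id s.
Proof.
case: p => //= [id' t v [[s' [[<-] _ cl]] _]|id' t v [[s' [[<-] _ cl]] _]|id' m [[s' [<-]
    cl] _]];
  by case=> <-.
Qed.

Lemma msg_ok_pval g L src d (p : payload) id t : msg_ok f g L src d p ->
  pval p = Some (id, t) -> exists2 w, id.1 = PW w & past_query g w id.2.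
Proof. by case: p => //= id' t' v [_ H] [<- _]. Qed.

Lemma inv_lower_sent g L s id : soda_inv g L -> sent_to L id s -> lower_sent f L id s.
Proof. by move=> I [src [p [/(inv_msg I)/msg_ok_lower_sent H /H]]]. Qed.

(** The relays below [s] were addressed before [s] was, and those above it by [s] itself, whose
    forwarding is complete because it is still alive. *)
Lemma inv_seen_sent g L s id : soda_inv g L -> ~~ s_crashed (gS g s) ->
  id \in s_seen (gS g s) -> forall x : 'I_n, x < f.+1 -> sent_to L id x.
Proof.
move=> I al sn x xf; have st := si_to (inv_S I s) sn.
case: (ltngtP x s) => [xs|sx|E].
- exact: (inv_lower_sent I st).
- by apply: (si_relay (inv_S I s) al sn) => //; lia.
by rewrite (_ : x = s) //; apply: val_inj.
Qed.

Lemma inv_id_tag g L id t : soda_inv g L -> id_tag L id t ->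
  exists2 w, id.1 = PW w & past_query g w id.2.
Proof. by move=> I [src [d [p [/(inv_msg I)/msg_ok_pval H /H]]]]. Qed.

Lemma rv_id_inj : injective (rv_id n).
Proof. by move=> [r op] [r' op'] [-> /eqP]; rewrite eqn_mul2l => /eqP ->. Qed.

Lemma inv_rv g L src s (p : payload) rd : soda_inv g L -> L src (PS s) p ->
  pid p = Some (rv_id n rd) ->
  exists2 tr, p = PMeta (rv_id n rd) (RV rd tr) & collecting g rd tr.
Proof.
move=> I /(inv_msg I); case: p => //= [id t v|id t c|id m].
- by move=> [_ [w ew _]] [E]; rewrite E in ew.
- by move=> [_ [w ew _]] [E]; rewrite E in ew.
move=> [_]; case: m => [rd' tr|rd' tr|t s' rd'] /= [H1 H2] [E]; rewrite {id}E in H1 *.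
- by move/rv_id_inj: H1 => ->; exists tr.
- by case: H1 => _; lia.
by case: H1.
Qed.

Lemma crashS_None (st : sstate) : crashS None st = st. Proof. by case: st. Qed.
Lemma crashW_None (st : wstate n V) : crashW None st = st. Proof. by case: st. Qed.
Lemma crashR_None (st : rstate n V C) : crashR None st = st. Proof. by case: st. Qed.

Lemma cut_crash_alive cut b : ~~ cut_crash cut b -> cut = None /\ ~~ b.
Proof. by case: cut. Qed.

(** For a server that changes at most by crashing. The condition on tags protects [si_tag]: an
    identifier already seen must not acquire a tag in the larger history. *)
Lemma server_inv_mono g L g' L' s cut :
  gS g' s = crashS cut (gS g s) -> state_le g g' -> sub_hist L L' ->
  (forall id t, id \in s_seen (gS g s) -> id_tag L' id t -> id_tag L id t) ->
  server_inv g L s -> server_inv g' L' s.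
Proof.
move=> E le sub vt [h1 h2 h3 h4 h5 h6 h7 h8 h9]; split; rewrite E /=.
- by move=> id /h1; apply: sent_to_mono.
- by move=> /cut_crash_alive[_ al] id x sn sf sx; apply: sent_to_mono sub _; apply: h2.
- by move=> id t sn /(vt _ _ sn); apply: h3.
- case: h4; first by left.
  by case=> id sn vtt; right; exists id => //; apply: id_tag_mono vtt.
- by [].
- by move=> rd tr /h6[-> /(le_collecting le)].
- by move=> /cut_crash_alive[_ al] t s' rd /(h7 al); apply: data_sent_mono.
- move=> /cut_crash_alive[_ al] rd /(h8 al)[]; first by left.
  by right; apply: enough_mono b.
by move=> /cut_crash_alive[_ al] rd tr R1 /(h9 al _ _ R1); apply: data_sent_mono.
Qed.

(** * Preservation of the invariant when a server handles a message *)

Section AtServer.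
Variables (g g' : gstate) (L : history) (s : 'I_n) (src : proc) (p : payload)
  (cut : option nat) (st : sstate) (o : out).
Hypothesis al : ~~ s_crashed (gS g s).
Hypothesis inn : in_net g src (PS s) p.
Hypothesis rc : recv_case f e Phi s (gS g s) src p st o.
Hypothesis ES : forall s', gS g' s' = if s' == s then crashS cut st else gS g s'.
Hypothesis EW : gW g' = gW g.
Hypothesis ER : gR g' = gR g.
Hypothesis ns : net_step g g' (PS s) (cut_out cut o) (Some (src, p)).
Hypothesis I : soda_inv g L.
Let L' := add_out L (PS s) (cut_out cut o).

Let ESs : gS g' s = crashS cut st. Proof. by rewrite ES eqxx. Qed.
Let sub : sub_hist L L'. Proof. exact: sub_add_out. Qed.
Let pok : msg_ok f g L src (PS s) p. Proof. exact: (inv_msg I (inv_net I inn)). Qed.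

Let le : state_le g g'.
Proof.
have [m1 m2 m3] := recv_case_mono rc.
split=> [s' id|rd|rd tr|w op|[w|r|s']].
- by rewrite ES; case: eqP => // -> /m1.
- by rewrite /finished ER.
- by rewrite /collecting /finished ER.
- by rewrite /past_query EW.
- by rewrite /= EW.
- by rewrite /= ER.
rewrite /= ES; case: eqP => // ->; by rewrite (negPf al).
Qed.

Let alive' : ~~ s_crashed (gS g' s) -> cut = None.
Proof. by rewrite ESs => /cut_crash_alive[]. Qed.

Let relays_at id fp : pid p = Some id -> (forall x, pid (fp x) = Some id) ->
  (forall (x : 'I_n) L1, s < x -> sub_hist L L1 -> lower_sent f L1 id x ->
     msg_ok f g' L1 (PS s) (PS x) (fp x)) ->
  sends_ok f g' L (PS s) (relays f s fp).
Proof.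
move=> pi idfp H; apply: (relays_ok idfp) => //; last exact: msg_ok_lower_sent pok pi.
by exists src, p; split=> //; exact: (inv_net I inn).
Qed.

Let sends : sends_ok f g' L (PS s) o.
Proof.
have ESs' := ESs; case: rc ESs' => [op _|_ _|id t c v st' o2 pv pi nid dv|id m err st' o2 b
    Ep nid dv] E //.
(* Here [spread] originates: [s] is alive when the step begins, so it has sent all copies it owed
   for identifiers seen earlier, even if it crashes right after this reply. *)
- split=> //=; case: (si_orig (inv_S I s)) => [|[id sn it]]; first by left.
  by right; exists id => //; apply: inv_seen_sent I al sn.
- apply: sends_ok_cat.
    apply: relays_at pi _ _ => [x|x L1 sx sb cl]; first by case: ifP.
    have [w ew pq] := msg_ok_pval pok pv.
    have pq' := le_past_query le pq.
    by case: ifP => xf; (split; last by exists w); exists x; split=> //; rewrite ltnNge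
        -ltnS xf.
  move: dv; rewrite value_deliverE => -[_ <-]; rewrite -cats1; apply: sends_ok_cat; last by [].
  apply: data_blocks_ok => -[rd tr]; rewrite mem_filter => /andP[_ /(si_R (inv_S I s))[sn co]].
  by split; [exact: le_seen le _ _ sn|exists tr; exact: le_collecting le _ _ co].
move: pok; rewrite Ep => -[_ mok]; apply: sends_ok_cat.
  apply: (relays_at (id := id)) => [|x|x L1 sx sb cl]; [by rewrite Ep|by []|].
  split; first by exists x.
  case: m mok {dv Ep} => [rd tr|rd tr|t s' rd] /= [h1 h2]; split=> //.
  - exact: le_collecting le _ _ h2.
  - exact: le_finished le _ h2.
  exact: data_sent_mono le sb h2.
have [_ sn' _] := meta_deliver_fields dv.
case: m mok dv {Ep} => [rd tr|rd tr|t s' rd] /=;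
  case Est: (gS g s) => [ts c R H seen cnt cr]; rewrite /mark_seen /=.
- move=> [h1 h2]; do ?case: ifP => _; case=> _ <- _ //;
    (apply: data_block_ok; [by rewrite E /= sn' -h1 mem_head|exact: le_collecting le _ _ h2]).
- by move=> _; case: ifP => _ [_ <- _].
by move=> _; case: ifP => _ [_ <- _].
Qed.

Let cut_sends : sends_ok f g' L (PS s) (cut_out cut o).
Proof. by rewrite /cut_out; case: (cut) => // j; apply: sends_ok_take. Qed.

Let msgs : forall src d p, L' src d p -> msg_ok f g' L' src d p.
Proof.
move=> src' d p' [/(inv_msg I) H|[-> H]]; first exact: msg_ok_mono le sub H.
exact: sends_ok_all cut_sends _ _ H.
Qed.

(** A server forwards a tag only under the identifier with which it came, so server steps attach no
    new tag to any identifier. *)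
Let o_pval d q : List.In (d, q) o -> forall x, pval q = Some x -> pval p = Some x.
Proof.
case: rc => [op _|_ _|id t c v st' o2 pv pi nid dv|id m err st' o2 b Ep nid dv] //=.
- by case=> // -[_ <-].
- rewrite In_cat => -[/relays_inv[x [_ -> _]] y|]; first by case: ifP; rewrite pv.
  move: dv; rewrite value_deliverE => -[_ <-]; rewrite -cats1 In_cat.
  by case=> [H|[[_ <-]|//]] x //=; rewrite (data_blocks_pval H).
by rewrite In_cat => -[/relays_inv[x [_ -> _]]|H x]; rewrite ?(meta_deliver_pval dv H).
Qed.

Let tags id t : id_tag L' id t -> id_tag L id t.
Proof.
case=> src' [d [q [[H|[_ H]] E]]]; first by exists src', d, q.
exists src, (PS s), p; split; first exact: (inv_net I inn).
apply: (@o_pval d) E; move: H; rewrite /cut_out; case: (cut) => [j|] //; exact: In_take.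
Qed.

Let other s' : s' != s -> server_inv g' L' s'.
Proof.
move=> ne; apply: (server_inv_mono (cut := None) _ le sub _ (inv_S I s')).
  by rewrite crashS_None ES (negPf ne).
by move=> id t _; apply: tags.
Qed.

Let tagseen id t : id \in s_seen st -> id_tag L id t ->
  tag_le t (s_tag st).
Proof.
have [m1 m2 m3] := recv_case_mono rc.
move=> /(recv_case_seen_inv rc)[sn|pi] it.
  exact: tag_le_trans (si_tag (inv_S I s) sn it) m2.
(* An identifier with a tag belongs to a writer, which rules out metadata in the last case below. *)
have [w ew _] := inv_id_tag I it.
case: rc pi => [op -> //|H _ pi|id' t' c v st' o2 pv -> nid dv [E]|id' m err st' o2 b Ep nid
    dv].
- exact: (si_tag (inv_S I s) (H _ pi (msg_ok_addressed pok)) it).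
- have it' : id_tag L id t' by exists src, (PS s), p; rewrite pv E; split=> //; exact:
    (inv_net I inn).
  rewrite (inv_tag I it it'); move: dv; rewrite value_deliverE => -[<- _] /=.
  by case: ifP; rewrite ?tag_le_refl // tag_ltNge => /negbFE.
move: pok; rewrite Ep => -[_] /= + [E]; rewrite -E in ew.
by case: m {dv Ep} => [rd tr|rd tr|t1 s1 rd] /= [H1 _]; move: ew; rewrite ?H1 //; case: H1
    => x ->.
Qed.

Let orig : s_tag st = t0 \/ exists2 id, id \in s_seen st & id_tag L' id (s_tag st).
Proof.
have old : s_tag (gS g s) = t0 \/
    exists2 id, id \in s_seen st & id_tag L' id (s_tag (gS g s)).
  have [m1 _ _] := recv_case_mono rc.
  case: (si_orig (inv_S I s)) => [|[id /m1 sn it]]; first by left.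
  by right; exists id => //; apply: id_tag_mono it.
case: rc old => [op _|_ _|id t c v st' o2 pv pi nid dv|id m err st' o2 b _ nid dv] //.
- move: dv; rewrite value_deliverE => -[<- _] /=; case: ifP => // _ _.
  right; exists id; first exact: mem_head.
  by exists src, (PS s), p; split=> //; left; exact: (inv_net I inn).
by have [-> _ _] := meta_deliver_fields dv.
Qed.

Let to_seen id : id \in s_seen st -> sent_to L' id s.
Proof.
case/(recv_case_seen_inv rc) => [sn|pi].
  exact: sent_to_mono sub (si_to (inv_S I s) sn).
by exists src, p; split=> //; left; exact: (inv_net I inn).
Qed.

Let relay_seen : cut = None -> forall id (x : 'I_n),
  id \in s_seen st -> s < f.+1 -> s < x -> sent_to L' id x.
Proof.
move=> Ec id x sn sf sx; case: (recv_case_relays rc sn) => [{}sn|[fp [o2 [Eo pi]]]].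
  exact: sent_to_mono sub (si_relay (inv_S I s) al sn sf sx).
exists (PS s), (fp x); split=> //; right; split=> //.
by rewrite Ec /= Eo In_cat; left; apply: In_relays.
Qed.

(** Only the clauses on [s_R] and [s_H] depend on which handler ran. The premises [cut = None] are
    what being alive after the step amounts to. *)
Let split_inv :
  [/\ uniq (s_H st),
      forall rd tr, (rd, tr) \in s_R st -> rv_id n rd \in s_seen st /\ collecting g' rd tr,
      cut = None -> forall t s' rd, (t, s', rd) \in s_H st -> data_sent g' L' s' t rd,
      cut = None -> forall rd, rv_id n rd \in s_seen st ->
        (exists tr, (rd, tr) \in s_R st) \/ enough f g' L' rd
    & cut = None -> forall rd tr, (rd, tr) \in s_R st -> tag_le tr (s_tag st) ->
        data_sent g' L' s (s_tag st) rd] -> server_inv g' L' s.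
Proof.
case=> h1 h2 h3 h4 h5; split; rewrite ESs /=.
- exact: to_seen.
- by move=> /cut_crash_alive[Ec _]; apply: relay_seen.
- by move=> id t sn /tags; apply: tagseen.
- exact: orig.
- by [].
- by [].
- by move=> /cut_crash_alive[Ec _]; apply: h3.
- by move=> /cut_crash_alive[Ec _]; apply: h4.
by move=> /cut_crash_alive[Ec _]; apply: h5.
Qed.

Let oldR rd tr : (rd, tr) \in s_R (gS g s) ->
  rv_id n rd \in s_seen st /\ collecting g' rd tr.
Proof.
have [m1 _ _] := recv_case_mono rc.
by case/(si_R (inv_S I s)) => /m1 H /(le_collecting le).
Qed.

Let oldH t s' rd : (t, s', rd) \in s_H (gS g s) -> data_sent g' L' s' t rd.
Proof. by move/(si_H (inv_S I s) al); apply: data_sent_mono. Qed.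

Let oldreg rd : rv_id n rd \in s_seen (gS g s) ->
  (exists tr, (rd, tr) \in s_R (gS g s)) \/ enough f g' L' rd.
Proof.
by case/(si_reg (inv_S I s) al); [left|right; apply: enough_mono le sub _].
Qed.

Let olddata rd tr : (rd, tr) \in s_R (gS g s) -> tag_le tr (s_tag (gS g s)) ->
  data_sent g' L' s (s_tag (gS g s)) rd.
Proof. by move=> inR /(si_data (inv_S I s) al inR); apply: data_sent_mono. Qed.

Let value_case id t c fp st' o2 :
  pid p = Some id -> pval p = Some (id, t) -> st = st' -> o = relays f s fp ++ o2 ->
  value_deliver f V s (mark_seen (gS g s) id) t c = (st', o2) -> server_inv g' L' s.
Proof.
move=> pi pv Est Eo E.
have new rd tr : cut = None -> (rd, tr) \in s_R (gS g s) -> tag_le tr t ->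
    data_sent g' L' s t rd.
  move: E; rewrite value_deliverE => -[_ Eo2] Ec inR le_t.
  right; exists c; right; split=> //.
  rewrite Ec /= Eo In_cat -Eo2 -cats1 In_cat; right; left.
  by apply: (@In_data_blocks _ _ _ _ _ _ _ _ _ (rd, tr)); rewrite mem_filter le_t.
(* A value never marks a READ-VALUE as seen, so [si_reg] gets no new case. *)
have notrv rd : rv_id n rd <> id.
  move=> Erd; rewrite -Erd in pi.
  by have [tr Ep _] := inv_rv I (inv_net I inn) pi; rewrite Ep in pv.
apply: split_inv; move: E; rewrite value_deliverE -Est => -[E1 _].
have ER' : s_R st = s_R (gS g s) by rewrite -E1.
have EH' : s_H st = addHs t s (s_H (gS g s)) [seq x <- s_R (gS g s) | tag_le x.2 t].
  by rewrite -E1.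
have Et : s_tag st = if tag_lt (s_tag (gS g s)) t then t else s_tag (gS g s).
  by rewrite -E1.
have Esn : s_seen st = id :: s_seen (gS g s) by rewrite -E1.
split.
- by rewrite EH'; apply: addHs_uniq; apply: si_uniq (inv_S I s).
- by rewrite ER'; apply: oldR.
- move=> Ec t' s' rd; rewrite EH' => /mem_addHs[/oldH //|[[rd' tr']]].
  by rewrite mem_filter => /andP[/= le_t inR] [-> -> ->]; apply: new inR le_t.
- move=> Ec rd; rewrite ER' Esn in_cons => /orP[/eqP/notrv //|]; exact: oldreg.
move=> Ec rd tr; rewrite ER' Et => inR; case: ifP => _ le_t; first exact: new inR le_t.
exact: olddata inR le_t.
Qed.

Let meta_step_inv id m fp st' o2 :
  p = PMeta id m -> id \notin s_seen (gS g s) -> st = st' -> o = relays f s fp ++ o2 ->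
  s_tag st' = s_tag (gS g s) -> s_seen st' = id :: s_seen (gS g s) ->
  meta_case f e s (mark_seen (gS g s) id) st' m o2 -> server_inv g' L' s.
Proof.
move=> Ep nid Est Eo; rewrite -Est => Et Esn mc.
have mok : meta_ok g' L' id m.
  have [_ ] : msg_ok f g' L' src (PS s) (PMeta id m); last by [].
  by rewrite -Ep; apply: msg_ok_mono le sub pok.
have Hu := si_uniq (inv_S I s).
apply: split_inv; rewrite Et Esn; case: mc Eo mok => {o2}.
- move=> rd tr inH E1 E2 _ [Eid co]; rewrite E1 E2 /=.
  (* The triple comes from an early READ-COMPLETE or from an element of tag [t0] sent by [s]. The
     latter would mean that [s] has seen this READ-VALUE before, but it is being delivered for the
     first time; hence the read is over. *)
  have fin : enough f g' L' rd.
    case: (si_H (inv_S I s) al inH) => [fin|[c /(inv_msg I)/=]].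
      by apply: finished_enough; apply: (le_finished le).
    by case=> s' [[<-] _ sn _]; rewrite Eid sn in nid.
  split.
  + exact: filter_uniq.
  + by rewrite -Esn; apply: oldR.
  + by move=> _ t s' rd'; rewrite mem_filter => /andP[_]; apply: oldH.
  + move=> _ rd'; rewrite in_cons => /orP[/eqP|]; last exact: oldreg.
    by rewrite Eid => /rv_id_inj ->; right.
  by move=> _ rd' tr'; apply: olddata.
- move=> rd tr c cnt nH E1 E2 Eo [Eid co]; rewrite E2 /=.
  have new : cut = None -> data_sent g' L' s (s_tag (gS g s)) rd.
    move=> Ec; right; exists c; right; split=> //.
    by rewrite Ec /= Eo In_cat; right; left.
  split.
  + exact: addH_uniq.
  + move=> rd' tr'; rewrite -Esn E1 in_cons => /orP[/eqP[-> ->]|]; last exact: oldR.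
    by rewrite Esn Eid mem_head.
  + move=> Ec t s' rd'; rewrite mem_addH => /orP[/eqP[-> -> ->]|]; [exact: new|exact: oldH].
  + move=> _ rd'; rewrite in_cons => /orP[/eqP|/oldreg].
      by rewrite Eid => /rv_id_inj ->; left; exists tr; rewrite E1 mem_head.
    by case=> [[tr' H]|]; [left; exists tr'; rewrite E1 in_cons H orbT|right].
  move=> Ec rd' tr'; rewrite E1 in_cons => /orP[/eqP[-> _] _|]; [exact: new|exact: olddata].
- move=> rd tr nH E1 E2 nle _ [Eid co]; rewrite E2 /=.
  split; first by [].
  + move=> rd' tr'; rewrite -Esn E1 in_cons => /orP[/eqP[-> ->]|]; last exact: oldR.
    by rewrite Esn Eid mem_head.
  + by move=> _ t s' rd'; apply: oldH.
  + move=> _ rd'; rewrite in_cons => /orP[/eqP|/oldreg].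
      by rewrite Eid => /rv_id_inj ->; left; exists tr; rewrite E1 mem_head.
    by case=> [[tr' H]|]; [left; exists tr'; rewrite E1 in_cons H orbT|right].
  (* The reader is registered without an element because the stored tag is not at least [tr], so
     [si_data] is void for the new pair. *)
  move=> Ec rd' tr'; rewrite E1 in_cons => /orP[/eqP[_ ->]|]; last exact: olddata.
  by rewrite (negPf nle).
- move=> rd tr E1 E2 _ [Eid fin]; rewrite E1 E2 /=.
  have inR x : x \in remR rd (s_R (gS g s)) -> x \in s_R (gS g s).
    by rewrite mem_filter => /andP[].
  split.
  + exact: filter_uniq.
  + by rewrite -Esn => rd' tr' /inR; apply: oldR.
  + by move=> _ t s' rd'; rewrite mem_filter => /andP[_]; apply: oldH.
  (* READ-COMPLETE has an odd counter and [rv_id] an even one. *)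
  + move=> _ rd'; rewrite in_cons Eid => /orP[/eqP[_]|/oldreg]; first by lia.
    case=> [[tr' H]|]; last by right.
    case: (eqVneq rd' rd) => [->|ne]; first by right; apply: finished_enough.
    by left; exists tr'; rewrite mem_filter /= ne.
  by move=> _ rd' tr' /inR; apply: olddata.
- move=> rd tr E1 E2 _ [Eid fin]; rewrite E1 E2 /=.
  split.
  + exact: addH_uniq.
  + by rewrite -Esn; apply: oldR.
  + move=> _ t s' rd'; rewrite mem_addH => /orP[/eqP[_ _ ->]|]; [by left|exact: oldH].
  + by move=> _ rd'; rewrite in_cons Eid => /orP[/eqP[_]|/oldreg //]; lia.
  by move=> _ rd' tr'; apply: olddata.
- move=> t s' rd E1 cnt E2 _ [[s1 Eid] ds]; rewrite E1 E2 /=.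
  have inR x : x \in remR rd (s_R (gS g s)) -> x \in s_R (gS g s).
    by rewrite mem_filter => /andP[].
  have dH t1 s2 rd1 : (t1, s2, rd1) \in addH (t, s', rd) (s_H (gS g s)) ->
      data_sent g' L' s2 t1 rd1.
    by rewrite mem_addH => /orP[/eqP[-> -> ->]|]; [|exact: oldH].
  have Hu' := addH_uniq (t, s', rd) Hu.
  (* The counted triples agree in tag and reader and the log has no duplicates, so their servers are
     distinct, and there are at least [n - f] of them. *)
  have en : enough f g' L' rd.
    exists t, [seq x.1.2 | x <- [seq x <- addH (t, s', rd) (s_H (gS g s)) |
                                 (x.1.1 == t) && (x.2 == rd)]]; split.
    * rewrite map_inj_in_uniq ?filter_uniq //.
      move=> [[t1 s2] r1] [[t2 s3] r2]; rewrite !mem_filter /=.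
      by move=> /andP[/andP[/eqP-> /eqP->] _] /andP[/andP[/eqP-> /eqP->] _] ->.
    * by rewrite size_map size_filter; apply: leq_trans cnt; rewrite /k; lia.
    move=> s2 /mapP[[[t1 s3] r1]]; rewrite mem_filter /=.
    by move=> /andP[/andP[/eqP-> /eqP->] /dH H] ->.
  split.
  + exact: filter_uniq.
  + by rewrite -Esn => rd' tr' /inR; apply: oldR.
  + by move=> _ t1 s2 rd'; rewrite mem_filter => /andP[_]; apply: dH.
  + move=> _ rd'; rewrite in_cons => /orP[/eqP Erd|/oldreg].
      by rewrite -Erd in Eid.
    case=> [[tr' H]|]; last by right.
    case: (eqVneq rd' rd) => [->|ne]; first by right.
    by left; exists tr'; rewrite mem_filter /= ne.
  by move=> _ rd' tr' /inR; apply: olddata.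
move=> t s' rd E1 E2 _ [[s1 Eid] ds]; rewrite E1 E2 /=.
split.
- exact: addH_uniq.
- by rewrite -Esn; apply: oldR.
- by move=> _ t1 s2 rd'; rewrite mem_addH => /orP[/eqP[-> -> ->]|]; [|exact: oldH].
- move=> _ rd'; rewrite in_cons => /orP[/eqP Erd|/oldreg //].
  by rewrite -Erd in Eid.
by move=> _ rd' tr'; apply: olddata.
Qed.

Let same_case : st = gS g s -> server_inv g' L' s.
Proof.
move=> Est; apply: (server_inv_mono (cut := cut) _ le sub _ (inv_S I s)).
  by rewrite ESs Est.
by move=> id t _; apply: tags.
Qed.

Let servers s' : server_inv g' L' s'.
Proof.
case: (eqVneq s' s) => [->|]; last exact: other.
case: (recv_caseE rc) => [[]|[id [t [c [fp [o2 [pi pv Eo E]]]]]]|[id [m [fp [o2 [[Ep nid] Eo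
    Et Esn mc]]]]]].
- by move=> /same_case.
- exact: value_case pi pv erefl Eo E.
exact: meta_step_inv Ep nid erefl Eo Et Esn mc.
Qed.

Let alive_back s' : ~~ s_crashed (gS g' s') -> ~~ s_crashed (gS g s').
Proof. by apply: contra => /(le_crashed le (p := PS s')). Qed.

Let keep_client src' c q : is_client c -> in_net g src' c q -> in_net g' src' c q.
Proof. by move=> cl /(in_net_keep ns)[//|[E _]]; rewrite E in cl. Qed.

Let pend src' s' q id : L' src' (PS s') q -> pid q = Some id ->
  id \in s_seen (gS g' s') \/ exists src' p', in_net g' src' (PS s') p' /\ pid p' = Some id.
Proof.
case=> [/(inv_pend I) H /H[/(le_seen le)|[src1 [p1 [/(in_net_keep ns)[H1|[[->] [_ <-]]]
    E1]]]]|].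
- by left.
- by right; exists src1, p1.
- by left; rewrite ESs; apply: recv_case_seen rc E1 (msg_ok_addressed pok).
by case=> _ H Eq; right; exists (PS s), q; split=> //; apply: net_sent ns _ _ H.
Qed.

Let queries c op reps s' : is_client c -> ~~ s_crashed (gS g' s') ->
  query_pending g c op reps s' -> query_pending g' c op reps s'.
Proof.
move=> cl al' [H|[t H]|/(in_net_keep ns)[H|[[Es] [Esrc Ep]]]].
- exact: Or31.
- by apply: Or32; exists t; apply: keep_client.
- exact: Or33.
apply: Or32; exists (s_tag (gS g s)); rewrite Es in al' *; apply: (net_sent ns).
rewrite (alive' al') /=.
case: (recv_caseE rc) => [[_ /(_ _ Ep) ->]|[id [t [c1 [fp [o2 []]]]]]|[id [m [fp [o2 [[]]]]]]].
- by left; rewrite Esrc.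
- by rewrite Ep.
by rewrite Ep.
Qed.

Let readers r : reader_inv g' L' r.
Proof.
have := inv_R I r; rewrite /reader_inv ER; case: (r_status _) => // [op reps|op tr pairs].
  case=> h1 h2 h3 h4; split=> // [x /h3|alr s' al']; first exact: spread_mono.
  by apply: queries => //; apply: h4 => //; apply: alive_back.
case=> h1 h2 h3 h4 h5; split=> //.
- exact: spread_mono h2.
- move=> s' t c [/h4[|[c' H]]|[-> H]]; first by left.
    by right; exists c'; apply: keep_client.
  by right; exists c; apply: (net_sent ns).
by move=> alr x xf; apply: sent_to_mono (h5 alr x xf).
Qed.

Let writers w : writer_inv g' L' w.
Proof.
have := inv_W I w; rewrite /writer_inv EW; case: (w_status _) => // [op v reps|tw acks].
  case=> h1 h2 h3; split=> // alw s' al'.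
  by apply: queries => //; apply: h3 => //; apply: alive_back.
case=> h1 h2 h3 h4 h5; split=> //.
- by move=> alw x xf; apply: sent_to_mono (h3 alw x xf).
- by move=> t /tags/h4.
move=> s' al'; have [Es|ne] := eqVneq s' s; last first.
  rewrite ES (negPf ne) => /(h5 _ (alive_back al'))[|H]; first by left.
  by right; apply: keep_client.
have old : (PW w, w_op (gW g w)) \in s_seen (gS g s) -> s \in acks \/ in_net g' (PS s) (PW
    w) (PAck tw).
  by move=> /(h5 _ al)[|H]; [left|right; apply: keep_client].
rewrite {s'}Es in al' *; rewrite ESs /=.
case: (recv_caseE rc) => [[-> _]|[id [t [c [fp [o2 [pi pv Eo]]]]]]|[id [m [fp [o2 [[Ep nid]
    Eo Et -> mc]]]]]].
- exact: old.
- rewrite value_deliverE => -[<- Eo2] /=; rewrite in_cons => /orP[/eqP Eid|]; last exact: old.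
  (* The acknowledgment goes to the writer named in the tag. It reaches [w] because the identifier
     of the current write carries no tag but [tw], whose second component is [w]. *)
  have Et : t = tw.
    by apply: h4; exists src, (PS s), p; rewrite Eid pv; split=> //; exact: (inv_net I inn).
  right; apply: (net_sent ns); rewrite (alive' al') /= Eo -Eo2 -cats1 !In_cat.
  by right; right; left; rewrite Et h1.
rewrite in_cons => /orP[/eqP Eid|]; last exact: old.
move: pok; rewrite Ep => -[_]; rewrite -Eid.
by case: (m) => [rd tr|rd tr|t s' rd] [] // [].
Qed.

Lemma server_step_inv : soda_inv g' L'.
Proof.
split=> //.
- by move=> src' d q /(net_new ns)[/(inv_net I)|[-> H]]; [left|right].
- by move=> id t t' /tags H1 /tags H2; exact: (inv_tag I H1 H2).
Qed.

End AtServer.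

End Invariant.

(** * Client steps *)

Section ClientStep.
Variables (n f e : nat) (V C : Type).
Variable Phi : 'I_n -> V -> C.
Variable Dec : seq ('I_n * C) -> V.
Hypothesis k_gt0 : 0 < k n f e.

Local Notation proc := (proc n).
Local Notation payload := (payload n V C).
Local Notation out := (out n V C).
Local Notation gstate := (gstate n V C).
Local Notation wstate := (wstate n V).
Local Notation rstate := (rstate n V C).
Local Notation iid := (iid n).
Local Notation history := (history n V C).
Implicit Types (g : gstate) (L : history) (id : iid) (t : Defs.tag) (s : 'I_n).

(** [WCaseNone] says that a reply of the awaited kind has no effect only if its sender is already
    counted; liveness uses this to turn the delivery of a reply into membership of its sender. *)
Inductive writer_case w (st : wstate) (src : proc) (p : payload) : wstate -> out -> Prop :=
| WCaseNone of
    (forall s op v reps t, src = PS s -> p = PRTag op t -> w_status st = WQuery op v reps ->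
       s \in unzip1 reps) &
    (forall s t acks, src = PS s -> p = PAck t -> w_status st = WAck V t acks -> s \in acks) :
    writer_case w st src p st [::]
| WCaseQuorum s op v reps t tm of src = PS s & p = PRTag op t & w_status st = WQuery op v
    reps :
    writer_case w st src p (WState (WAck V (tm, w) [::]) (w_op st) (w_crashed st))
      [seq (PS s', PVal (PW w, op) (tm, w) v) | s' <- prims n f]
| WCaseReply s op v reps t of src = PS s & p = PRTag op t & w_status st = WQuery op v reps
    & 2 * size (rcons reps (s, t)) <= n :
    writer_case w st src p
      (WState (WQuery op v (rcons reps (s, t))) (w_op st) (w_crashed st)) [::]
| WCaseDone t acks of w_status st = WAck V t acks :
    writer_case w st src p (WState (WIdle n V) (w_op st) (w_crashed st)) [::]
| WCaseAck s t acks of src = PS s & p = PAck t & w_status st = WAck V t acks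
    & size (rcons acks s) < k n f e :
    writer_case w st src p (WState (WAck V t (rcons acks s)) (w_op st) (w_crashed st)) [::].

Lemma writer_recvP w st src p st' o :
  writer_recv f e w st src p = (st', o) -> writer_case w st src p st' o.
Proof.
case: src => [x|x|s]; try by case=> <- <-; apply: WCaseNone.
case: p => [op|op t|id t v|id t c|t|id m|rd t c]; try by case=> <- <-; apply: WCaseNone.
- rewrite /writer_recv; case Est: (w_status st) => [|op0 v reps|tw acks];
    try by case=> <- <-; apply: WCaseNone => // *; congruence.
  case: ifP => [/andP[/eqP Eop nin]|nin].
    case: ifP => [q|/negbT nq] [<- <-]; first by rewrite -Eop in Est *; eapply WCaseQuorum;
        eauto.
    by rewrite -Eop in Est *; eapply WCaseReply; eauto; rewrite leqNgt.
  case=> <- <-; apply: WCaseNone => // s' op' v' reps' t' [<-] [Eop Et]; rewrite Est =>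
      -[Eop' _ <-].
  by move: nin; rewrite Eop Eop' eqxx /= => /negbFE.
rewrite /writer_recv; case Est: (w_status st) => [|op0 v reps|tw acks];
  try by case=> <- <-; apply: WCaseNone => // *; congruence.
case: ifP => [/andP[/eqP Eop nin]|nin].
  case: ifP => [q|/negbT nq] [<- <-]; first exact: WCaseDone Est.
  by rewrite -Eop in Est *; eapply WCaseAck; eauto; rewrite ltnNge.
case=> <- <-; apply: WCaseNone => // s' t' acks' [<-] [<-]; rewrite Est => -[Et <-].
by move: nin; rewrite Et eqxx /= => /negbFE.
Qed.

Inductive reader_case r (st : rstate) (src : proc) (p : payload) : rstate -> out -> Prop :=
| RCaseNone of
    (forall s op reps t, src = PS s -> p = PRTag op t -> r_status st = RQuery C op reps ->
       s \in unzip1 reps) &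
    (forall s op tr pairs t c, src = PS s -> p = PData (r, op) t c ->
       r_status st = RColl op tr pairs -> collected pairs s t) :
    reader_case r st src p st [::]
| RCaseQuorum s op reps t of src = PS s & p = PRTag op t & r_status st = RQuery C op reps :
    let tr := max_tag (unzip2 (rcons reps (s, t))) in
    reader_case r st src p (RState (RColl op tr [::]) (r_op st) (r_val st) (r_crashed st))
      (md_meta f V C (PR r) (2 * op) (RV (r, op) tr))
| RCaseReply s op reps t of src = PS s & p = PRTag op t & r_status st = RQuery C op reps
    & 2 * size (rcons reps (s, t)) <= n :
    reader_case r st src p
      (RState (RQuery C op (rcons reps (s, t))) (r_op st) (r_val st) (r_crashed st)) [::]
| RCaseDone op tr pairs v of r_status st = RColl op tr pairs :
    reader_case r st src p (RState (RIdle n C) (r_op st) v (r_crashed st))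
      (md_meta f V C (PR r) (2 * op).+1 (RC (r, op) tr))
| RCaseData s op tr pairs t c of src = PS s & p = PData (r, op) t c
    & r_status st = RColl op tr pairs
    & size [seq x <- rcons pairs (s, t, c) | x.1.2 == t] < k n f e + 2 * e :
    reader_case r st src p
      (RState (RColl op tr (rcons pairs (s, t, c))) (r_op st) (r_val st) (r_crashed st)) [::].

Lemma reader_recvP r st src p st' o :
  reader_recv f e Dec r st src p = (st', o) -> reader_case r st src p st' o.
Proof.
case: src => [x|x|s]; try by case=> <- <-; apply: RCaseNone.
case: p => [op|op t|id t v|id t c|t|id m|rd t c]; try by case=> <- <-; apply: RCaseNone.
- rewrite /reader_recv; case Est: (r_status st) => [|op0 reps|op0 tr pairs];
    try by case=> <- <-; apply: RCaseNone => // *; congruence.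
  case: ifP => [/andP[/eqP Eop nin]|nin].
    case: ifP => [q|/negbT nq] [<- <-]; first by rewrite -Eop in Est *; eapply RCaseQuorum;
        eauto.
    by rewrite -Eop in Est *; eapply RCaseReply; eauto; rewrite leqNgt.
  case=> <- <-; apply: RCaseNone => // s' op' reps' t' [<-] [Eop Et]; rewrite Est => -[Eop'
      <-].
  by move: nin; rewrite Eop Eop' eqxx /= => /negbFE.
rewrite /reader_recv; case Est: (r_status st) => [|op0 reps|op0 tr pairs];
  try by case=> <- <-; apply: RCaseNone => // *; congruence.
case: ifP => [/andP[/eqP Erd nin]|nin].
  rewrite size_map; case: ifP => [q|/negbT nq] [<- <-]; first exact: RCaseDone Est.
  by eapply RCaseData; eauto; rewrite ?Erd // ltnNge.
case=> <- <-; apply: RCaseNone => // s' op' tr' pairs' t' c' [<-] [Erd <- _].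
rewrite Est => -[Eop _ <-].
by move: nin; rewrite Erd Eop eqxx /= => /negbFE.
Qed.

Lemma inv_sent_past g L w op s : soda_inv f e g L -> sent_to L (PW w, op) s -> past_query g
    w op.
Proof.
move=> I [src [p [/(inv_msg I)]]]; case: p => //= [id t v|id t c|id m].
- by move=> [_ [w' + +]] [E]; rewrite E /= => -[->].
- by move=> [_ [w' + +]] [E]; rewrite E /= => -[->].
by move=> [_ mok] [E]; move: mok; rewrite E; case: m => [rd tr|rd tr|t s' rd] [] // [].
Qed.

(** * Steps that leave the servers unchanged except for crashes *)

Section AtClient.
Variables (g g' : gstate) (L : history) (a : proc) (o : out) (d : option (proc * payload)).
Hypothesis HS : forall s, exists cut, gS g' s = crashS cut (gS g s).
Hypothesis ns : net_step g g' a o d.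
Hypothesis Hd : isSome d -> is_client a.
Hypothesis le : state_le g g'.
Hypothesis I : soda_inv f e g L.
Let L' := add_out L a o.

(** A new tag may be attached only to an identifier that has no other tag and that no server has
    seen; this preserves [inv_tag] and the clause [si_tag] of every server. *)
Lemma client_step_inv :
  sends_ok f g' L a o ->
  (forall id t, id_tag L' id t -> id_tag L id t \/
     ((forall t', id_tag L' id t' -> t' = t) /\ forall s, id \notin s_seen (gS g s))) ->
  (forall r, reader_inv f e g' L' r) -> (forall w, writer_inv f e g' L' w) ->
  soda_inv f e g' L'.
Proof.
move=> sok vt HR HW.
have sub : sub_hist L L' by apply: sub_add_out.
split=> //.
- by move=> src q p /(net_new ns)[/(inv_net I)|[-> H]]; [left|right].
- move=> src q p [/(inv_msg I) H|[-> H]]; first exact: msg_ok_mono le sub H.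
  exact: sends_ok_all sok _ _ H.
- move=> src s p id [/(inv_pend I) H /H[/(le_seen le)|[src' [p' [H1 E]]]]|[_ H] E].
  + by left.
  + case: (in_net_keep ns H1) => [|[Ea Ed]]; first by right; exists src', p'.
    by move: Hd; rewrite Ed -Ea => /(_ isT).
  by right; exists a, p; split=> //; apply: (net_sent ns).
- move=> id t t' H1 H2; case: (vt _ _ H1) => [h1|[H _]]; last by rewrite (H _ H2).
  case: (vt _ _ H2) => [h2|[H _]]; last exact: H.
  exact: (inv_tag I h1 h2).
move=> s; have [cut E] := HS s.
apply: (server_inv_mono E le sub _ (inv_S I s)) => id t sn /vt[//|[_ H]].
by have := H s; rewrite sn.
Qed.

Let alive_back s : ~~ s_crashed (gS g' s) -> ~~ s_crashed (gS g s).
Proof. by apply: contra => H; apply: (le_crashed le (p := PS s)). Qed.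

Let keepS src s p : in_net g src (PS s) p -> in_net g' src (PS s) p.
Proof. by move/(in_net_keep ns) => [//|[Ea Ed]]; move: Hd; rewrite Ed -Ea => /(_ isT). Qed.

Lemma query_pending_mono c op reps s :
  (forall t, in_net g (PS s) c (PRTag op t) -> in_net g' (PS s) c (PRTag op t)
     \/ s \in unzip1 reps) ->
  query_pending g c op reps s -> query_pending g' c op reps s.
Proof.
move=> Hk [H|[t /Hk[H|H]]|/keepS H]; [exact: Or31| |exact: Or31|exact: Or33].
by apply: Or32; exists t.
Qed.

Lemma reader_inv_idle r cut : (PR r <> a \/ d = None) -> gR g' r = crashR cut (gR g r) ->
  reader_inv f e g' L' r.
Proof.
move=> ne E.
have keep' src p : in_net g src (PR r) p -> in_net g' src (PR r) p.
  by move/(in_net_keep ns) => [//|[E1 E2]]; case: ne; rewrite ?E1 ?E2.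
have := inv_R I r; rewrite /reader_inv E /=; case: (r_status _) => // [op reps|op tr pairs].
  case=> h1 h2 h3 h4; split=> // [x /h3|/cut_crash_alive[_ al] s als].
    by apply: spread_mono; apply: sub_add_out.
  apply: query_pending_mono (h4 al s (alive_back als)) => t /keep'; by left.
case=> h1 h2 h3 h4 h5; split=> //.
- by apply: spread_mono h2; apply: sub_add_out.
- move=> s t c [/h4[|[c' /keep' H]]|[E1 H]]; [by left|by right; exists c'|].
  by right; exists c; rewrite E1; apply: (net_sent ns).
move=> /cut_crash_alive[_ al] x xf; apply: sent_to_mono (h5 al x xf); exact: sub_add_out.
Qed.

Lemma writer_inv_idle w cut : (PW w <> a \/ d = None) -> gW g' w = crashW cut (gW g w) ->
  (forall op t, id_tag L' (PW w, op) t -> id_tag L (PW w, op) t) ->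
  writer_inv f e g' L' w.
Proof.
move=> ne E vt.
have keep' src p : in_net g src (PW w) p -> in_net g' src (PW w) p.
  by move/(in_net_keep ns) => [//|[E1 E2]]; case: ne; rewrite ?E1 ?E2.
have := inv_W I w; rewrite /writer_inv E /=; case: (w_status _) => // [op v reps|tw acks].
  case=> h1 h2 h3; split=> // /cut_crash_alive[_ al] s als.
  by apply: query_pending_mono (h3 al s (alive_back als)) => t /keep'; left.
case=> h1 h2 h3 h4 h5; split=> //.
- move=> /cut_crash_alive[_ al] x xf; apply: sent_to_mono (h3 al x xf); exact: sub_add_out.
- by move=> t /vt/h4.
move=> s als; have [cut' Es] := HS s; rewrite Es /=.
by move/(h5 _ (alive_back als)) => [|/keep']; [left|right].
Qed.

End AtClient.

Lemma quiet_step_inv g g' L a :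
  (forall s, gS g' s = gS g s \/ gS g' s = crashS (Some 0) (gS g s)) ->
  (forall w, gW g' w = gW g w \/ gW g' w = crashW (Some 0) (gW g w)) ->
  (forall r, gR g' r = gR g r \/ gR g' r = crashR (Some 0) (gR g r)) ->
  net_step g g' a [::] None -> soda_inv f e g L -> soda_inv f e g' (add_out L a [::]).
Proof.
move=> HS HW HR ns I.
have HS' s : exists cut, gS g' s = crashS cut (gS g s).
  by case: (HS s) => ->; [exists None; rewrite crashS_None|exists (Some 0)].
have HW' w : exists cut, gW g' w = crashW cut (gW g w).
  by case: (HW w) => ->; [exists None; rewrite crashW_None|exists (Some 0)].
have HR' r : exists cut, gR g' r = crashR cut (gR g r).
  by case: (HR r) => ->; [exists None; rewrite crashR_None|exists (Some 0)].
have le : state_le g g'.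
  split=> [s id|rd|rd tr|w op|[w|r|s]].
  - by have [cut ->] := HS' s.
  - by rewrite /finished; have [cut ->] := HR' rd.1.
  - by rewrite /collecting /finished; have [cut ->] := HR' rd.1.
  - by rewrite /past_query; have [cut ->] := HW' w.
  - by have [cut /= ->] := HW' w; case: cut.
  - by have [cut /= ->] := HR' r; case: cut.
  by have [cut /= ->] := HS' s; case: cut.
have back id t : id_tag (add_out L a [::]) id t -> id_tag L id t.
  by case=> [src [q [p [[H|[_ []]] E]]]]; exists src, q, p.
apply: (client_step_inv HS' ns _ le I) => //.
- by move=> id t /back; left.
- by move=> r; have [cut E] := HR' r; apply: (reader_inv_idle ns _ le I _ E) => //; right.
move=> w; have [cut E] := HW' w.
by apply: (writer_inv_idle HS' ns _ le I _ E) => //; [right|move=> op t /back].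
Qed.

Lemma In_cut_out cut (o : out) x : List.In x (cut_out cut o) -> List.In x o.
Proof. by case: cut => // j; apply: In_take. Qed.

Lemma sends_ok_cut g L a cut o : sends_ok f g L a o -> sends_ok f g L a (cut_out cut o).
Proof. by case: cut => // j; apply: sends_ok_take. Qed.

(** * Preservation of the invariant by the steps of a writer *)

Section AtWriter.
Variables (g g' : gstate) (L : history) (w : nat) (cut : option nat) (st : wstate)
  (o : out) (d : option (proc * payload)).
Hypothesis al : ~~ w_crashed (gW g w).
Hypothesis EW : forall w', gW g' w' = if w' == w then crashW cut st else gW g w'.
Hypothesis ES : gS g' = gS g.
Hypothesis ER : gR g' = gR g.
Hypothesis ns : net_step g g' (PW w) (cut_out cut o) d.
Hypothesis I : soda_inv f e g L.
Let L' := add_out L (PW w) (cut_out cut o).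

Let EWw : gW g' w = crashW cut st. Proof. by rewrite EW eqxx. Qed.
Let HS s : exists c, gS g' s = crashS c (gS g s).
Proof. by exists None; rewrite crashS_None ES. Qed.

(** During the query phase the identifier of the write does not satisfy [past_query], while
    everything sent under a writer's identifier does; so nothing has been sent under it. *)
Let no_idle op v reps : w_status (gW g w) = WQuery op v reps ->
  (forall t, ~ id_tag L (PW w, op) t) /\ (forall s, (PW w, op) \notin s_seen (gS g s)).
Proof.
move=> Est; have := inv_W I w; rewrite /writer_inv Est => -[Eop _ _].
have np : ~ past_query g w op.
  by rewrite /past_query Eop ltnn => -[//|[_ /(_ op v reps)]]; rewrite Est.
split=> [t /(inv_id_tag I)[w' [<-]] //|s].
by apply/negP => /(si_to (inv_S I s))/(inv_sent_past I).
Qed.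

Let writer_common tw :
  (forall op, past_query g w op -> past_query g' w op) ->
  (state_le g g' -> sends_ok f g' L (PW w) o) ->
  (forall q p id t, List.In (q, p) (cut_out cut o) -> pval p = Some (id, t) ->
     [/\ id = (PW w, w_op (gW g w)), t = tw & exists op v reps, w_status (gW g w) = WQuery
         op v reps]) ->
  (state_le g g' -> writer_inv f e g' L' w) ->
  soda_inv f e g' L'.
Proof.
move=> pq sok new wi.
have le : state_le g g'.
  split=> [s id|rd|rd tr|w' op|[w'|r|s]].
  - by rewrite ES.
  - by rewrite /finished ER.
  - by rewrite /collecting /finished ER.
  - by case: (eqVneq w' w) => [->|ne]; [exact: pq|rewrite /past_query EW (negPf ne)].
  - by rewrite /= EW; case: eqP => [->|//]; rewrite (negPf al).
  - by rewrite /= ER.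
  by rewrite /= ES.
have vt id t : id_tag L' id t -> id_tag L id t \/
   [/\ id = (PW w, w_op (gW g w)), t = tw & exists op v reps, w_status (gW g w) = WQuery op
       v reps].
  by case=> [src [q [p [[H|[_ /new H]] E]]]]; [left; exists src, q, p|right; apply: H].
have own id : [/\ id = (PW w, w_op (gW g w)) & exists op v reps, w_status (gW g w) = WQuery
    op v reps] ->
    (forall t, ~ id_tag L id t) /\ (forall s, id \notin s_seen (gS g s)).
  case=> -> [op [v [reps Est]]]; have := inv_W I w; rewrite /writer_inv Est => -[<- _ _].
  exact: no_idle Est.
apply: (client_step_inv HS ns _ le I) => //.
- exact: sends_ok_cut (sok le).
- move=> id t /vt[|[Eid Et Eq]]; [by left|right].
  have [h1 h2] := own id (conj Eid Eq); split=> // t' /vt[/h1 //|[_ -> _]]; by rewrite Et.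
- move=> r; apply: (reader_inv_idle (cut := None) ns _ le I) => //; first by left.
  by rewrite crashR_None ER.
move=> w'; case: (eqVneq w' w) => [->|ne]; first exact: wi.
apply: (writer_inv_idle (cut := None) HS ns _ le I) => //.
- by left=> -[E]; rewrite E eqxx in ne.
- by rewrite crashW_None EW (negPf ne).
by move=> op t /vt[//|[[E _] _ _]]; rewrite E eqxx in ne.
Qed.

Let keepS src s p : in_net g src (PS s) p -> in_net g' src (PS s) p.
Proof. by move=> /(in_net_keep ns)[//|[]]. Qed.

Lemma write_invoke_inv v : w_status (gW g w) = WIdle n V ->
  writer_invoke C (gW g w) v = (st, o) -> soda_inv f e g' L'.
Proof.
(* The messages sent here carry no tag, so [t0] is a dummy. *)
move=> idl [Est Eo]; apply: (writer_common (tw := t0)).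
- move=> op; rewrite /past_query EWw -Est /= => -[lt|[-> _]]; by left; lia.
- move=> _; rewrite -Eo; elim: (enum _) (L) => //= s l IH L1; by split; [|exact: IH].
- by move=> q p id t /In_cut_out; rewrite -Eo => /In_map[s _ [_ ->]].
move=> le; rewrite /writer_inv EWw -Est /=; split=> //.
move=> /cut_crash_alive[Ec _] s _; apply: Or33.
apply: (net_sent ns); rewrite Ec /= -Eo; apply/In_map; exists s => //.
by apply/In_mem; rewrite mem_enum.
Qed.

Lemma write_recv_inv src p : d = Some (src, p) -> in_net g src (PW w) p ->
  writer_case w (gW g w) src p st o -> soda_inv f e g' L'.
Proof.
move=> Ed inn wc; have wi := inv_W I w; rewrite /writer_inv in wi.
have qmono op reps reps' s : query_pending g (PW w) op reps s ->
    {subset unzip1 reps <= unzip1 reps'} ->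
    (forall t, src = PS s -> p = PRTag op t -> s \in unzip1 reps') ->
    query_pending g' (PW w) op reps' s.
  move=> qp sb own.
  case: qp => [/sb H|[t H]|/keepS H]; [exact: Or31| |exact: Or33].
  case: (in_net_keep ns H) => [H'|[_ E]]; first by apply: Or32; exists t.
  by move: E; rewrite Ed => -[E1 E2]; apply: Or31; apply: own E1 E2.
(* [st] and [o] occur in the section hypotheses, so the case analysis is made on copies tied to them
   by equations. *)
have [st' [o' [wc' E1 E2]]] : exists st' o',
    [/\ writer_case w (gW g w) src p st' o', st' = st & o' = o] by exists st, o.
have noout : o = [::] -> forall q p id t, List.In (q, p) (cut_out cut o) ->
    pval p = Some (id, t) -> [/\ id = (PW w, w_op (gW g w)), t = t0
      & exists op v reps, w_status (gW g w) = WQuery op v reps].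
  by move=> -> q p' id t /In_cut_out.
have notag : o = [::] -> forall id t, id_tag L' id t -> id_tag L id t.
  move=> Eo id t [src' [q [p' [[H|[_ /In_cut_out H]] E]]]]; first by exists src', q, p'.
  by rewrite Eo in H.
have sub : sub_hist L L' by apply: sub_add_out.
case: wc' E1 E2 wi {wc} => [own1 own2|s op v reps t tm Es Ep Est|s op v reps t Es Ep Est
    sz|t acks Est|s t acks Es Ep Est sz] E1 E2 wi.
- apply: (writer_common (tw := t0)) (noout (esym E2)) _.
  + by move=> op; rewrite /past_query EWw -E1.
  + by rewrite -E2.
  move=> _; rewrite /writer_inv EWw -E1 /=; case Est: (w_status _) wi => [|op v reps|t acks]
      //.
    case=> h1 h2 h3; split=> // /cut_crash_alive[_ _] s; rewrite ES => als.
    by apply: qmono (h3 al s als) _ _ => // t E3 E4; apply: own1 E3 E4 Est.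
  case=> h1 h2 h3 h4 h5; split=> //.
  + by move=> _ x xf; apply: sent_to_mono sub (h3 al x xf).
  + by move=> t' /(notag (esym E2))/h4.
  move=> s; rewrite ES => als /(h5 s als)[|H]; first by left.
  case: (in_net_keep ns H) => [|[_ E]]; first by right.
  by left; move: E; rewrite Ed => -[E3 E4]; apply: own2 E3 E4 Est.
- have Eop : op = w_op (gW g w) by rewrite Est in wi; case: wi.
  have pq : past_query g' w op by right; rewrite EWw -E1 Eop.
  have [nt ns'] := no_idle Est.
  have o_tag q p' id t' : List.In (q, p') (cut_out cut o) -> pval p' = Some (id, t') ->
      id = (PW w, op) /\ t' = (tm, w).
    by move=> /In_cut_out; rewrite -E2 => /In_map[x _ [_ ->]] [<- <-].
  apply: (writer_common (tw := (tm, w))).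
  + move=> op'; rewrite /past_query EWw -E1 /= Est => -[lt|[_ /(_ op v reps)//]]; by left.
  + move=> _; rewrite -E2; apply: (prims_bcast_ok (id := (PW w, op))) => // x L1.
    rewrite mem_prims => xf _ ls; split; first by exists x.
    by exists w.
  + move=> q p' id t' H E; have [-> ->] := o_tag _ _ _ _ H E; rewrite Eop; split=> //.
    by exists op, v, reps.
  move=> _; rewrite /writer_inv EWw -E1 /= -Eop; split=> //.
  + move=> /cut_crash_alive[Ec _] x xf; exists (PW w), (PVal (PW w, op) (tm, w) v); split=> //.
    right; split=> //; rewrite Ec /= -E2; apply/In_map; exists x => //.
    by apply/In_mem; rewrite mem_prims.
  + move=> t' [src' [q [p' [[H|[_ H]] E]]]]; last by case: (o_tag _ _ _ _ H E).
    by case: (nt t'); exists src', q, p'.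
  by move=> s'; rewrite ES => _ sn; have := ns' s'; rewrite sn.
- apply: (writer_common (tw := t0)) (noout (esym E2)) _.
  + move=> op'; rewrite /past_query EWw -E1 /= Est => -[lt|[_ /(_ op v reps)//]]; by left.
  + by rewrite -E2.
  move=> _; rewrite /writer_inv EWw -E1 /=; move: wi; rewrite Est => -[h1 h2 h3].
  split=> // /cut_crash_alive[_ _] s'; rewrite ES => als.
  apply: qmono (h3 al s' als) _ _.
    by move=> x; rewrite /unzip1 map_rcons mem_rcons in_cons orbC => ->.
  move=> t'; rewrite Es => -[->] _; by rewrite /unzip1 map_rcons mem_rcons mem_head.
- apply: (writer_common (tw := t0)) (noout (esym E2)) _.
  + move=> op'; rewrite /past_query EWw -E1 /= => -[lt|[-> _]]; [by left|by right].
  + by rewrite -E2.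
  by move=> _; rewrite /writer_inv EWw -E1 /=.
apply: (writer_common (tw := t0)) (noout (esym E2)) _.
- move=> op'; rewrite /past_query EWw -E1 /= => -[lt|[-> _]]; [by left|by right].
- by rewrite -E2.
move=> _; rewrite /writer_inv EWw -E1 /=; move: wi; rewrite Est => -[h1 h2 h3 h4 h5].
split=> //.
- by move=> _ x xf; apply: sent_to_mono sub (h3 al x xf).
- by move=> t' /(notag (esym E2))/h4.
move=> s'; rewrite ES => als /(h5 s' als)[H|H].
  by left; rewrite mem_rcons in_cons H orbT.
case: (in_net_keep ns H) => [|[_ E]]; first by right.
by left; move: E; rewrite Ed Es => -[[->] _]; rewrite mem_rcons mem_head.
Qed.

End AtWriter.

(** * Preservation of the invariant by the steps of a reader *)

Section AtReader.
Variables (g g' : gstate) (L : history) (r : nat) (cut : option nat) (st : rstate)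
  (o : out) (d : option (proc * payload)).
Hypothesis al : ~~ r_crashed (gR g r).
Hypothesis ER : forall r', gR g' r' = if r' == r then crashR cut st else gR g r'.
Hypothesis ES : gS g' = gS g.
Hypothesis EW : gW g' = gW g.
Hypothesis ns : net_step g g' (PR r) (cut_out cut o) d.
Hypothesis I : soda_inv f e g L.
Let L' := add_out L (PR r) (cut_out cut o).

Let ERr : gR g' r = crashR cut st. Proof. by rewrite ER eqxx. Qed.
Let HS s : exists c, gS g' s = crashS c (gS g s).
Proof. by exists None; rewrite crashS_None ES. Qed.

Let reader_common :
  (forall op, finished g (r, op) -> finished g' (r, op)) ->
  (forall op tr, collecting g (r, op) tr -> collecting g' (r, op) tr) ->
  (state_le g g' -> sends_ok f g' L (PR r) o) ->
  (forall q p, List.In (q, p) o -> pval p = None) ->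
  (state_le g g' -> reader_inv f e g' L' r) ->
  soda_inv f e g' L'.
Proof.
move=> fin col sok new ri.
have le : state_le g g'.
  split=> [s id|[r' op]|[r' op] tr|w' op|[w'|r'|s]].
  - by rewrite ES.
  - by case: (eqVneq r' r) => [->|ne]; [exact: fin|rewrite /finished /= ER (negPf ne)].
  - case: (eqVneq r' r) => [->|ne]; first exact: col.
    by rewrite /collecting /finished /= ER (negPf ne).
  - by rewrite /past_query EW.
  - by rewrite /= EW.
  - by rewrite /= ER; case: eqP => [->|//]; rewrite (negPf al).
  by rewrite /= ES.
have vt id t : id_tag L' id t -> id_tag L id t.
  case=> [src [q [p [[H|[_ /In_cut_out/new H]] E]]]]; first by exists src, q, p.
  by rewrite E in H.
apply: (client_step_inv HS ns _ le I) => //.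
- exact: sends_ok_cut (sok le).
- by move=> id t /vt; left.
- move=> r'; case: (eqVneq r' r) => [->|ne]; first exact: ri.
  apply: (reader_inv_idle (cut := None) ns _ le I) => //.
    by left=> -[E]; rewrite E eqxx in ne.
  by rewrite crashR_None ER (negPf ne).
move=> w; apply: (writer_inv_idle (cut := None) HS ns _ le I) => //; first by left.
- by rewrite crashW_None EW.
by move=> op t /vt.
Qed.

Let keepS src s p : in_net g src (PS s) p -> in_net g' src (PS s) p.
Proof. by move=> /(in_net_keep ns)[//|[]]. Qed.

Lemma read_invoke_inv : r_status (gR g r) = RIdle n C ->
  reader_invoke (gR g r) = (st, o) -> soda_inv f e g' L'.
Proof.
move=> idl [Est Eo]; apply: reader_common.
- move=> op; rewrite /finished /= ERr -Est /= => -[lt|[-> _]]; by left; lia.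
- move=> op tr [fin|[pairs]]; last by rewrite /= idl.
  by left; move: fin; rewrite /finished /= ERr -Est /= => -[lt|[-> _]]; left; lia.
- move=> _; rewrite -Eo; elim: (enum _) (L) => //= s l IH L1; by split; [|exact: IH].
- by move=> q p; rewrite -Eo => /In_map[s _ [_ ->]].
move=> le; rewrite /reader_inv ERr -Est /=; split=> //.
move=> /cut_crash_alive[Ec _] s _; apply: Or33.
apply: (net_sent ns); rewrite Ec /= -Eo; apply/In_map; exists s => //.
by apply/In_mem; rewrite mem_enum.
Qed.

Lemma read_recv_inv src p : d = Some (src, p) -> in_net g src (PR r) p ->
  reader_case r (gR g r) src p st o -> soda_inv f e g' L'.
Proof.
move=> Ed inn wc; have ri := inv_R I r; rewrite /reader_inv in ri.
have qmono op reps reps' s : query_pending g (PR r) op reps s ->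
    {subset unzip1 reps <= unzip1 reps'} ->
    (forall t, src = PS s -> p = PRTag op t -> s \in unzip1 reps') ->
    query_pending g' (PR r) op reps' s.
  move=> qp sb own.
  case: qp => [/sb H|[t H]|/keepS H]; [exact: Or31| |exact: Or33].
  case: (in_net_keep ns H) => [H'|[_ E]]; first by apply: Or32; exists t.
  by move: E; rewrite Ed => -[E1 E2]; apply: Or31; apply: own E1 E2.
have [st' [o' [wc' E1 E2]]] : exists st' o',
    [/\ reader_case r (gR g r) src p st' o', st' = st & o' = o] by exists st, o.
have sub : sub_hist L L' by apply: sub_add_out.
have newdata s t c op : L' (PS s) (PR r) (PData (r, op) t c) ->
    L (PS s) (PR r) (PData (r, op) t c) by case=> // -[].
have pok := inv_msg I (inv_net I inn).
case: wc' E1 E2 ri {wc} => [own1 own2|s op reps t Es Ep Est tr|s op reps t Es Ep Est sz|op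
    tr pairs v Est|s op tr pairs t c Es Ep Est sz] E1 E2 ri.
- apply: reader_common.
  + by move=> op; rewrite /finished /= ERr -E1.
  + by move=> op tr; rewrite /collecting /finished /= ERr -E1.
  + by rewrite -E2.
  + by rewrite -E2.
  move=> _; rewrite /reader_inv ERr -E1 /=; case Est: (r_status _) ri => [|op reps|op tr
      pairs] //.
    case=> h1 h2 h3 h4; split=> // [x /h3|/cut_crash_alive[_ _] s]; first exact: spread_mono.
    rewrite ES => als.
    by apply: qmono (h4 al s als) _ _ => // t E3 E4; apply: own1 E3 E4 Est.
  case=> h1 h2 h3 h4 h5; split=> //.
  + exact: spread_mono h2.
  + move=> s t c /newdata/h4[|[c' H]]; first by left.
    case: (in_net_keep ns H) => [|[_ E]]; first by right; exists c'.
    by left; move: E; rewrite Ed => -[E3 E4]; apply: own2 E3 E4 Est.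
  by move=> _ x xf; apply: sent_to_mono sub (h5 al x xf).
- have [Eop _ h3 _] : [/\ op = r_op (gR g r), 2 * size reps <= n,
      forall x, x \in reps -> spread f L x.2 & True] by rewrite Est in ri; case: ri.
  have nofin : ~ finished g (r, op).
    by rewrite /finished /= Eop ltnn Est => -[|[]].
  apply: reader_common.
  + move=> op'; rewrite /finished /= ERr -E1 /= Est => -[lt|[]] //; by left.
  + move=> op' tr' [fin|[pairs]]; last by rewrite /= Est.
    by left; move: fin; rewrite /finished /= ERr -E1 /= Est => -[lt|[]] //; left.
  + move=> _; rewrite -E2; apply: md_meta_ok; split=> //.
    by right; exists [::]; rewrite /= ERr -E1.
  + by move=> q p'; rewrite -E2 => H; rewrite (md_meta_pval H).
  move=> _; rewrite /reader_inv ERr -E1 /=; split=> //.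
  + apply: (spread_mono sub); rewrite /tr.
    (* [max_tag] starts from [t0], so the maximum is [t0] or one of the reported tags; both are
       spread. *)
    have [->|] := max_tag_cases (unzip2 (rcons reps (s, t))); first by left.
    rewrite /unzip2 map_rcons mem_rcons in_cons => /orP[/eqP ->|/mapP[x /h3 H ->] //].
    by move: pok; rewrite Ep.
  + by move=> _; lia.
  (* No element for this read exists yet: [msg_ok] would require the read to be collecting or over,
     and it is still querying. *)
  + move=> s' t' c /newdata /(inv_msg I)[s1 [_ _ _ [tr' [//|[pairs]]]]].
    by rewrite /= Est.
  move=> /cut_crash_alive[Ec _] x xf.
  exists (PR r), (PMeta (PR r, 2 * op) (RV (r, op) tr)); split=> //.
  right; split=> //; rewrite Ec /= -E2; apply/In_map; exists x => //.
  by apply/In_mem; rewrite mem_prims.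
- apply: reader_common.
  + move=> op'; rewrite /finished /= ERr -E1 /= Est => -[lt|[]] //; by left.
  + move=> op' tr' [fin|[pairs]]; last by rewrite /= Est.
    by left; move: fin; rewrite /finished /= ERr -E1 /= Est => -[lt|[]] //; left.
  + by rewrite -E2.
  + by rewrite -E2.
  move=> _; rewrite /reader_inv ERr -E1 /=; move: ri; rewrite Est => -[h1 h2 h3 h4].
  split=> //.
  + move=> x; rewrite mem_rcons in_cons => /orP[/eqP ->|/h3]; last exact: spread_mono.
    by apply: spread_mono sub _; move: pok; rewrite Ep.
  move=> /cut_crash_alive[_ _] s'; rewrite ES => als.
  apply: qmono (h4 al s' als) _ _.
    by move=> x; rewrite /unzip1 map_rcons mem_rcons in_cons orbC => ->.
  move=> t'; rewrite Es => -[->] _; by rewrite /unzip1 map_rcons mem_rcons mem_head.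
- have Eop : op = r_op (gR g r) by rewrite Est in ri; case: ri.
  have fin' : finished g' (r, op) by right; rewrite /= ERr -E1.
  apply: reader_common.
  + move=> op'; rewrite /finished /= ERr -E1 /= Est => -[lt|[]] //; by left.
  + move=> op' tr' [fin|[pairs']].
      by left; move: fin; rewrite /finished /= ERr -E1 /= Est => -[lt|[]] //; left.
    by rewrite /= Est => -[<- _ _]; left.
  + by move=> _; rewrite -E2; apply: md_meta_ok.
  + by move=> q p'; rewrite -E2 => H; rewrite (md_meta_pval H).
  by move=> _; rewrite /reader_inv ERr -E1 /=.
apply: reader_common.
- move=> op'; rewrite /finished /= ERr -E1 /= Est => -[lt|[]] //; by left.
- move=> op' tr' [fin|[pairs']].
    by left; move: fin; rewrite /finished /= ERr -E1 /= Est => -[lt|[]] //; left.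
  by rewrite /= Est => -[<- <- _]; right; exists (rcons pairs (s, t, c)); rewrite ERr -E1.
- by rewrite -E2.
- by rewrite -E2.
move=> _; rewrite /reader_inv ERr -E1 /=; move: ri; rewrite Est => -[h1 h2 h3 h4 h5].
split=> //.
- exact: spread_mono h2.
- move=> t'; case: (eqVneq t t') => [<- //|ne].
  by rewrite filter_rcons /= (negPf ne).
- move=> s' t' c' /newdata/h4[H|[c1 H]].
    by left; rewrite /collected has_rcons; apply/orP; right.
  case: (in_net_keep ns H) => [|[_ E]]; first by right; exists c1.
  left; move: E; rewrite Ed Es Ep => -[<- <- _].
  by rewrite /collected has_rcons /= !eqxx.
by move=> _ x xf; apply: sent_to_mono sub (h5 al x xf).
Qed.

End AtReader.

Lemma tstep_inv (v0 : V) g g' L a o d : tstep f e Phi Dec g g' a o d -> net_step g g' a o d ->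
  soda_inv f e g L -> soda_inv f e g' (add_out L a o).
Proof.
case=> {a o d}.
- move=> s src p err cut st o u al inn rc ES EW ER ns I.
  exact: (server_step_inv al inn (server_recvP v0 rc) ES EW ER ns I).
- move=> w v cut st o al idl E EW ES ER ns I.
  exact: (write_invoke_inv al EW ES ER ns I idl E).
- move=> w src p cut st o al inn E EW ES ER ns I.
  exact: (write_recv_inv al EW ES ER ns I erefl inn (writer_recvP E)).
- move=> r cut st o al idl E ER ES EW ns I.
  exact: (read_invoke_inv al ER ES EW ns I idl E).
- move=> r src p cut st o al inn E ER ES EW ns I.
  exact: (read_recv_inv al ER ES EW ns I erefl inn (reader_recvP E)).
move=> a HS HW HR ns I; exact: quiet_step_inv HS HW HR ns I.
Qed.

Lemma init_inv v0 : soda_inv f e (init Phi v0) (fun _ _ _ => False).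
Proof.
split=> //.
- by move=> src d p [i].
- by move=> id t t' [src [d [p []]]].
move=> s; split=> //=; by left.
Qed.

End ClientStep.

(** * Liveness *)

Section Liveness.
Variables (n f e : nat) (V C : Type).
Variable Phi : 'I_n -> V -> C.
Variable Dec : seq ('I_n * C) -> V.
Variable v0 : V.
Hypothesis f_small : f <= (n - 1) %/ 2.
Hypothesis k_gt0 : 0 < k n f e.

Local Notation proc := (proc n).
Local Notation payload := (payload n V C).
Local Notation out := (out n V C).
Local Notation gstate := (gstate n V C).
Local Notation iid := (iid n).
Local Notation history := (history n V C).
Local Notation soda_inv := (soda_inv f e).
Implicit Types (id : iid) (t : Defs.tag) (s : 'I_n).

Variable sigma : nat -> gstate.
Hypothesis exec : execution f e Phi Dec v0 sigma.
Hypothesis reliable : reliable_channels sigma.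
Hypothesis few_crashes : at_most_f_server_crashes f sigma.

(** A message is in the network right after the step that sends it, so the messages sent by time [i]
    are those in transit at some time up to [i]. *)
Definition past i : history :=
  fun src d p => exists2 i', i' <= i & in_net (sigma i') src d p.

Lemma past_mono i j : i <= j -> sub_hist (past i) (past j).
Proof. by move=> ij src d p [i' Hi H]; exists i' => //; lia. Qed.

Lemma past_step i a o d : net_step (sigma i) (sigma i.+1) a o d ->
  past i.+1 = add_out (past i) a o.
Proof.
move=> ns; do 3 (apply: functional_extensionality => ?).
apply: propositional_extensionality; split.
  case=> i'; rewrite leq_eqVlt => /orP[/eqP -> /(net_new ns)[H|]|lt H]; last 2 first.
  - by right.
  - by left; exists i'.
  by left; exists i.
case=> [[i' le H]|[-> /(net_sent ns) H]]; first by exists i' => //; lia.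
by exists i.+1.
Qed.

Lemma past_inv i : mids_ok (sigma i) /\ soda_inv (sigma i) (past i).
Proof.
have [E0 St] := exec.
elim: i => [|i [ok I]].
  rewrite E0; split; first by split.
  rewrite (_ : past 0 = fun _ _ _ => False); first exact: init_inv.
  do 3 (apply: functional_extensionality => ?).
  apply: propositional_extensionality; split=> // -[i'].
  by rewrite leqn0 => /eqP ->; rewrite E0 => -[].
have [a [o [d [ts ns ok']]]] := step_tstep ok (St i).
by split=> //; rewrite (past_step ns); apply: tstep_inv v0 _ _ _ _ _ _ ts ns I.
Qed.

Lemma run_inv i : soda_inv (sigma i) (past i).
Proof. by have [] := past_inv i. Qed.

Lemma run_step i : exists a o d,
  tstep f e Phi Dec (sigma i) (sigma i.+1) a o d /\ net_step (sigma i) (sigma i.+1) a o d.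
Proof.
have [ok _] := past_inv i; have [_ St] := exec.
by have [a [o [d [ts ns _]]]] := step_tstep ok (St i); exists a, o, d.
Qed.

Lemma tstep_server_mono (g g' : gstate) a o d s : tstep f e Phi Dec g g' a o d ->
  [/\ forall id, id \in s_seen (gS g s) -> id \in s_seen (gS g' s),
      tag_le (s_tag (gS g s)) (s_tag (gS g' s))
    & s_crashed (gS g s) -> s_crashed (gS g' s)].
Proof.
have refl (st st' : sstate n C) : st = st' -> [/\ forall id, id \in s_seen st -> id \in
    s_seen st',
    tag_le (s_tag st) (s_tag st') & s_crashed st -> s_crashed st'].
  by move=> ->; split=> //; apply: tag_le_refl.
case=> [s' src p err cut st o' u al _ /(server_recvP v0) rc ES _ _|w v cut st o' _ _ _ _ -> _
  |w src p cut st o' _ _ _ _ -> _|r cut st o' _ _ _ _ -> _|r src p cut st o' _ _ _ _ -> _|a'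
      HS _ _];
  try exact: refl.
  rewrite ES; case: eqP => [->|_]; last exact: refl.
  have [m1 m2 m3] := recv_case_mono rc; split=> //.
  by rewrite /= m3; case: (cut).
by case: (HS s) => ->; [exact: refl|split=> //; apply: tag_le_refl].
Qed.

Lemma run_server_mono i j s : i <= j ->
  [/\ forall id, id \in s_seen (gS (sigma i) s) -> id \in s_seen (gS (sigma j) s),
      tag_le (s_tag (gS (sigma i) s)) (s_tag (gS (sigma j) s))
    & s_crashed (gS (sigma i) s) -> s_crashed (gS (sigma j) s)].
Proof.
elim: j => [|j IH]; first by rewrite leqn0 => /eqP ->; split=> //; apply: tag_le_refl.
rewrite leq_eqVlt => /orP[/eqP ->|/IH[h1 h2 h3]]; first by split=> //; apply: tag_le_refl.
have [a [o [d [ts _]]]] := run_step j.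
have [m1 m2 m3] := tstep_server_mono s ts; split; last by move=> /h3/m3.
  by move=> id /h1/m1.
exact: tag_le_trans h2 m2.
Qed.

Lemma first_change (P : nat -> Prop) i j : i <= j -> P i -> ~ P j ->
  exists l, [/\ i <= l, l < j, P l & ~ P l.+1].
Proof.
move=> ij Pi; elim: j ij => [|j IH]; first by rewrite leqn0 => /eqP <-.
rewrite leq_eqVlt => /orP[/eqP <- //|ij] nPj.
case: (classic (P j)) => Pj; first by exists j; split.
by have [l [h1 h2 h3 h4]] := IH ij Pj; exists l; split=> //; lia.
Qed.

(** Reliability only promises that the message disappears. By [net_keep], the step in which it does
    is its delivery. *)
Lemma delivery i src d p : in_net (sigma i) src d p ->
  (forall j, ~~ crashed (sigma j) d) ->
  exists j, i <= j /\ exists o, tstep f e Phi Dec (sigma j) (sigma j.+1) d o (Some (src, p)) /\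
    net_step (sigma j) (sigma j.+1) d o (Some (src, p)).
Proof.
move=> [m inm] al; have [j [ij nin]] := reliable inm al.
have [l [il _ inl nl]] := @first_change (fun l => List.In (Msg m src d p) (gnet (sigma l)))
    _ _ ij inm nin.
exists l; split=> //; have [a [o [d' [ts ns]]]] := run_step l; exists o.
by case: (net_keep ns inl) => [//|[/= -> <-]].
Qed.

Definition live s := forall j, ~~ s_crashed (gS (sigma j) s).

Lemma tstep_at_server (g g' : gstate) s o src p :
  tstep f e Phi Dec g g' (PS s) o (Some (src, p)) -> ~~ s_crashed (gS g' s) ->
  recv_case f e Phi s (gS g s) src p (gS g' s) o.
Proof.
move=> ts; inversion ts as [s' src' p' err cut st o' u al inn rc ES| | | | |]; subst.
rewrite ES eqxx => /cut_crash_alive[-> _].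
by rewrite crashS_None; apply: server_recvP rc.
Qed.

Lemma tstep_at_writer (g g' : gstate) w o src p :
  tstep f e Phi Dec g g' (PW w) o (Some (src, p)) ->
  exists cut st o', writer_case f e w (gW g w) src p st o' /\ gW g' w = crashW cut st.
Proof.
move=> ts; inversion ts as [| |w' src' p' cut st o' al inn rc EW| | |]; subst.
by exists cut, st, o'; rewrite EW eqxx; split=> //; apply: writer_recvP rc.
Qed.

Lemma tstep_at_reader (g g' : gstate) r o src p :
  tstep f e Phi Dec g g' (PR r) o (Some (src, p)) ->
  exists cut st o', reader_case f e r (gR g r) src p st o' /\ gR g' r = crashR cut st.
Proof.
move=> ts; inversion ts as [| | | |r' src' p' cut st o' al inn rc ER|]; subst.
by exists cut, st, o'; rewrite ER eqxx; split=> //; apply: reader_recvP rc.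
Qed.

(** Persistence allows the finitely many individual times to be replaced by their maximum. *)
Lemma eventually_all (T : eqType) (P : nat -> T -> Prop) i (N : seq T) :
  (forall j l x, i <= j -> j <= l -> P j x -> P l x) ->
  (forall x, x \in N -> exists2 j, i <= j & P j x) ->
  exists2 j, i <= j & forall x, x \in N -> P j x.
Proof.
move=> mono; elim: N => [|y N IH] H; first by exists i.
have [|j ij Hj] := IH; first by move=> x xN; apply: H; rewrite in_cons xN orbT.
have [l il Hl] := H y (mem_head _ _).
exists (maxn j l); first by lia.
move=> x; rewrite in_cons => /orP[/eqP ->|/Hj Hx].
  by apply: mono Hl => //; lia.
by apply: mono Hx => //; lia.
Qed.

(** [0 < k] excludes [n = 0], a case that the bound on [f] with its truncated [n - 1] would
    admit. *)
Lemma f_lt_n : f.+1 <= n /\ n < 2 * (n - f).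
Proof. by have : 0 < n - f - 2 * e by []; move: f_small; rewrite leq_divRL //; lia. Qed.

(** Crashes are permanent and the servers finite in number, so at some time [i0] all faulty servers
    have crashed, and the bound on crashes at [i0] counts every one of them. *)
Lemma live_servers : exists N : seq 'I_n,
  [/\ uniq N, n - f <= size N, forall s, s \in N -> live s & exists2 q, q \in N & q < f.+1].
Proof.
have mono i j s : i <= j -> s_crashed (gS (sigma i) s) -> s_crashed (gS (sigma j) s).
  by move=> ij; have [] := run_server_mono s ij.
have [i0 _ H] : exists2 i0, 0 <= i0 & forall s, s \in enum 'I_n ->
    s_crashed (gS (sigma i0) s) \/ live s.
  apply: eventually_all => [j l s _ jl [/(mono _ _ _ jl) cr|lv]|s _]; [by left|by right|].
  case: (classic (live s)) => [|/not_all_ex_not[j /negP/negPn cr]]; first by exists 0 => //;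
      right.
  by exists j => //; left.
have cc := few_crashes i0; set P := (fun s => s_crashed _) in cc.
exists [seq s <- enum 'I_n | ~~ P s]; split.
- by rewrite filter_uniq // enum_uniq.
- have := count_predC P (enum 'I_n); rewrite size_filter size_enum_ord => E.
  by rewrite (_ : count _ _ = count (predC P) (enum 'I_n)) //; lia.
- by move=> s; rewrite mem_filter => /andP[ns /H[|//]]; rewrite -/(P s) (negPf ns).
have [fn _] := f_lt_n.
(* With no live relay, all [f + 1] relays would be among the at most [f] crashed servers. *)
apply: NNPP => no; suff : f.+1 <= count P (enum 'I_n) by lia.
rewrite -size_filter -(size_enum_ord f.+1) -(size_map (widen_ord fn)).
apply: uniq_leq_size; first by rewrite map_inj_uniq ?enum_uniq // => x y /(congr1 val) /=
    /val_inj.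
move=> s /mapP[x _ ->]; rewrite mem_filter mem_enum andbT; apply/negPn/negP => nP.
apply: no; exists (widen_ord fn x); first by rewrite mem_filter nP mem_enum.
exact: (ltn_ord x).
Qed.

Lemma sent_seen i id s : live s -> sent_to (past i) id s ->
  exists2 j, i <= j & id \in s_seen (gS (sigma j) s).
Proof.
move=> lv [src [p [/(inv_pend (run_inv i)) H /H[sn|[src' [p' [inn E]]]]]]]; first by exists i.
have [j [ij [o [ts _]]]] := delivery inn lv.
exists j.+1; first by lia.
have rc := tstep_at_server ts (lv _).
have inj : msg_ok f (sigma j) (past j) src' (PS s) p'.
  by apply: (inv_msg (run_inv j)); exists i.
exact: recv_case_seen rc E (msg_ok_addressed inj).
Qed.

(** * Dissemination and progress relative to a fixed set of live servers *)

Section LiveSet.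
Variable N : seq 'I_n.
Hypothesis N_uniq : uniq N.
Hypothesis N_big : n - f <= size N.
Hypothesis N_live : forall s, s \in N -> live s.
Variable q : 'I_n.
Hypothesis qN : q \in N.
Hypothesis q_prim : q < f.+1.

(** Relays are addressed directly. The other servers depend on the live relay [q], which sees the
    identifier and, being alive, has then forwarded it to them. *)
Lemma sent_all_seen i id : (forall x : 'I_n, x < f.+1 -> sent_to (past i) id x) ->
  exists2 j, i <= j & forall s, s \in N -> id \in s_seen (gS (sigma j) s).
Proof.
move=> sp; have [j ij sn] := sent_seen (N_live qN) (sp q q_prim).
have [||l jl H] := @eventually_all _ (fun l s => id \in s_seen (gS (sigma l) s)) j N.
- by move=> l l' x _ ll; have [+ _ _] := run_server_mono x ll; apply.
- move=> s sN; apply: sent_seen (N_live sN) _.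
  case: (ltnP s f.+1) => sf; first by apply: sent_to_mono (past_mono ij) (sp s sf).
  by apply: (si_relay (inv_S (run_inv j) q) (N_live qN j) sn) => //; lia.
by exists l => //; lia.
Qed.

Lemma seen_all_seen i id s : live s -> id \in s_seen (gS (sigma i) s) ->
  exists2 j, i <= j & forall s, s \in N -> id \in s_seen (gS (sigma j) s).
Proof. by move=> lv sn; apply: sent_all_seen; apply: inv_seen_sent (run_inv i) (lv i) sn. Qed.

(** Shared by writers and readers: [waiting j reps] stands for being in the query phase with replies
    [reps]. The replies of all of [N] would be counted eventually, but [2 * size reps <= n]
    contradicts [n < 2 * (n - f)]. *)
Lemma query_majority i (c : proc) op (waiting : nat -> seq ('I_n * Defs.tag) -> Prop) :
  (forall j, ~~ crashed (sigma j) c) ->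
  (forall j, i <= j -> exists reps, [/\ waiting j reps, 2 * size reps <= n
     & forall s, ~~ s_crashed (gS (sigma j) s) -> query_pending (sigma j) c op reps s]) ->
  (forall j reps, i <= j -> waiting j reps ->
     exists2 reps', waiting j.+1 reps' & {subset unzip1 reps <= unzip1 reps'}) ->
  (forall j s t o, i <= j ->
     tstep f e Phi Dec (sigma j) (sigma j.+1) c o (Some (PS s, PRTag op t)) ->
     exists2 reps, waiting j.+1 reps & s \in unzip1 reps) ->
  (forall j reps reps', waiting j reps -> waiting j reps' -> reps = reps') ->
  False.
Proof.
move=> alc pend grow deliv func.
pose P j s := exists2 reps, waiting j reps & s \in unzip1 reps.
have got j s t : i <= j -> in_net (sigma j) (PS s) c (PRTag op t) -> exists2 l, i <= l & P l s.
  move=> ij /delivery/(_ alc)[l [jl [o [ts _]]]]; exists l.+1; first by lia.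
  by apply: deliv ts; lia.
have [|s sN|j ij H] := @eventually_all _ P i N.
- move=> j l s ij jl; elim: l jl => [|l IH]; first by rewrite leqn0 => /eqP ->.
  rewrite leq_eqVlt => /orP[/eqP -> //|jl] /(IH jl)[reps w sr].
  have [|reps' w' sub] := grow l reps _ w; first by lia.
  by exists reps' => //; apply: sub.
- have [reps [w _ /(_ _ (N_live sN i))]] := pend i (leqnn i).
  case=> [sr|[t H]|/delivery/(_ (N_live sN))[j [ij [o [ts ns]]]]].
  + by exists i => //; exists reps.
  + exact: got H.
  have rc := tstep_at_server ts (N_live sN _).
  case: (recv_caseE rc) => [[_ /(_ _ erefl) Eo]|[id [t [c1 [fp [o2 []]]]]]|[id [m [fp [o2
      [[]]]]]]] //.
  apply: (@got j.+1 s (s_tag (gS (sigma j) s))); first by lia.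
  by apply: (net_sent ns); rewrite Eo; left.
have [reps [w sz _]] := pend j ij.
have le : size N <= size (unzip1 reps).
  apply: uniq_leq_size => // s /H[reps' w' sr].
  by rewrite (func _ _ _ w w').
have [_ maj] := f_lt_n; rewrite size_map in le; lia.
Qed.

Lemma tstep_writer_busy (g g' : gstate) a o d w : tstep f e Phi Dec g g' a o d ->
  w_status (gW g w) <> WIdle n V ->
  (exists cut, gW g' w = crashW cut (gW g w)) \/
  exists src (p : payload) cut st o', writer_case f e w (gW g w) src p st o' /\ gW g' w =
      crashW cut st.
Proof.
have same (st st' : wstate n V) : st' = st -> exists cut, st' = crashW cut st.
  by move=> ->; exists None; rewrite crashW_None.
case=> [s src p err cut st o' u _ _ _ _ EW _|w' v cut st o' _ idl _ EW _ _
  |w' src p cut st o' _ _ rc EW _ _|r cut st o' _ _ _ _ _ EW|r src p cut st o' _ _ _ _ _ EW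
  |a' _ HW _] busy.
- by left; apply: same; rewrite EW.
- rewrite EW; case: eqP => [E|_]; last by left; apply: same.
  by rewrite E in busy.
- rewrite EW; case: eqP => [E|_]; last by left; apply: same.
  by right; exists src, p, cut, st, o'; rewrite E; split=> //; apply: writer_recvP rc.
- by left; apply: same; rewrite EW.
- by left; apply: same; rewrite EW.
by left; case: (HW w) => ->; [exact: same|exists (Some 0)].
Qed.

Lemma tstep_reader_busy (g g' : gstate) a o d r : tstep f e Phi Dec g g' a o d ->
  r_status (gR g r) <> RIdle n C ->
  (exists cut, gR g' r = crashR cut (gR g r)) \/
  exists src (p : payload) cut st o', reader_case f e r (gR g r) src p st o' /\ gR g' r =
      crashR cut st.
Proof.
have same (st st' : rstate n V C) : st' = st -> exists cut, st' = crashR cut st.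
  by move=> ->; exists None; rewrite crashR_None.
case=> [s src p err cut st o' u _ _ _ _ _ ER|w v cut st o' _ _ _ _ _ ER
  |w src p cut st o' _ _ _ _ _ ER|r' cut st o' _ idl _ ER _ _|r' src p cut st o' _ _ rc ER _ _
  |a' _ _ HR] busy.
- by left; apply: same; rewrite ER.
- by left; apply: same; rewrite ER.
- by left; apply: same; rewrite ER.
- rewrite ER; case: eqP => [E|_]; last by left; apply: same.
  by rewrite E in busy.
- rewrite ER; case: eqP => [E|_]; last by left; apply: same.
  by right; exists src, p, cut, st, o'; rewrite E; split=> //; apply: reader_recvP rc.
by left; case: (HR r) => ->; [exact: same|exists (Some 0)].
Qed.

(** * A writer that stays busy leads to a contradiction *)

Section WriterProgress.
Variables (w i0 : nat).
Hypothesis w_live : forall j, ~~ w_crashed (gW (sigma j) w).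
Hypothesis busy : forall j, i0 <= j -> w_status (gW (sigma j) w) <> WIdle n V.

Lemma writer_leaves_query op v reps : w_status (gW (sigma i0) w) = WQuery op v reps ->
  exists j t acks, i0 <= j /\ w_status (gW (sigma j) w) = WAck V t acks.
Proof.
move=> Est0; apply: NNPP => no.
have query j : i0 <= j -> exists v' reps', w_status (gW (sigma j) w) = WQuery op v' reps'.
  elim: j => [|j IH]; first by rewrite leqn0 => /eqP <-; exists v, reps.
  rewrite leq_eqVlt => /orP[/eqP <-|ij]; first by exists v, reps.
  have [v' [reps' Est]] := IH ij; have [a [o [d [ts _]]]] := run_step j.
  case: (tstep_writer_busy ts (busy ij)) => [[cut ->]|[src [p [cut [st [o' [wc E]]]]]]].
    by exists v', reps'.
  rewrite E; case: wc E => [_ _|s op1 v1 r1 t tm _ _ E1|s op1 v1 r1 t _ _ E1 _|t acks E1|s t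
      acks _ _ E1 _] E.
  - by exists v', reps'.
  - by case: no; exists j.+1, (tm, w), [::]; split; [lia|rewrite E].
  - by exists v1, (rcons r1 (s, t)); move: E1; rewrite Est => -[-> _ _].
  - by rewrite Est in E1.
  by rewrite Est in E1.
apply: (query_majority (i := i0) (c := PW w) (op := op)
  (waiting := fun j reps => exists v, w_status (gW (sigma j) w) = WQuery op v reps)) => //.
- move=> j ij; have [v' [reps' Est]] := query j ij.
  have := inv_W (run_inv j) w; rewrite /writer_inv Est => -[_ h2 h3].
  by exists reps'; split=> //; [exists v'|exact: h3].
- move=> j reps1 ij [v1 Est]; have [a [o [d [ts _]]]] := run_step j.
  case: (tstep_writer_busy ts (busy ij)) => [[cut E]|[src [p [cut [st [o' [wc E]]]]]]].
    by exists reps1 => //; exists v1; rewrite E.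
  case: wc E => [_ _|s op2 v2 r2 t tm _ _ E1|s op2 v2 r2 t _ _ E1 _|t acks E1|s t acks _ _
      E1 _] E.
  + by exists reps1 => //; exists v1; rewrite E.
  + by case: no; exists j.+1, (tm, w), [::]; split; [lia|rewrite E].
  + exists (rcons r2 (s, t)); first by exists v2; move: E1; rewrite E Est => -[-> _ _].
    move=> x; move: E1; rewrite Est => -[_ _ ->].
    by rewrite /unzip1 map_rcons mem_rcons in_cons orbC => ->.
  + by rewrite Est in E1.
  by rewrite Est in E1.
- move=> j s t o ij ts; have [v1 [reps1 Est]] := query j ij.
  have [cut [st [o' [wc E]]]] := tstep_at_writer ts.
  case: wc E => [own _|s2 op2 v2 r2 t2 tm _ _ E1|s2 op2 v2 r2 t2 Es Ep E1 _|t2 acks E1|s2 t2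
      acks _ _ E1 _] E.
  + by exists reps1; [exists v1; rewrite E|exact: own erefl erefl Est].
  + by case: no; exists j.+1, (tm, w), [::]; split; [lia|rewrite E].
  + exists (rcons r2 (s2, t2)); first by exists v2; move: E1; rewrite E Est => -[-> _ _].
    by case: Es => ->; rewrite /unzip1 map_rcons mem_rcons mem_head.
  + by rewrite Est in E1.
  by rewrite Est in E1.
by move=> j r1 r2 [v1 E1] [v2 E2]; move: E2; rewrite E1 => -[_ ->].
Qed.

(** Every server of [N] sees the identifier of the write and acknowledges it, and
    [k <= n - f <= size N]. The identifier stays the same because the operation number does not
    change while the writer waits. *)
Lemma writer_gets_acks t acks : w_status (gW (sigma i0) w) <> WAck V t acks.
Proof.
move=> Est0; pose id : iid := (PW w, w_op (gW (sigma i0) w)).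
have ack j : i0 <= j -> exists2 acks', w_status (gW (sigma j) w) = WAck V t acks' &
    w_op (gW (sigma j) w) = w_op (gW (sigma i0) w).
  elim: j => [|j IH]; first by rewrite leqn0 => /eqP <-; exists acks.
  rewrite leq_eqVlt => /orP[/eqP <-|ij]; first by exists acks.
  have [acks' Est Eop] := IH ij; have [a [o [d [ts _]]]] := run_step j.
  case: (tstep_writer_busy ts (busy ij)) => [[cut ->]|[src [p [cut [st [o' [wc E]]]]]]].
    by exists acks'.
  have nidle := busy (leqW ij).
  rewrite E in nidle *; case: wc nidle => [_ _|s op1 v1 r1 t1 tm _ _ E1|s op1 v1 r1 t1 _ _
      E1 _|t1 acks1 E1|s t1 acks1 _ _ E1 _] nidle.
  - by exists acks'.
  - by rewrite Est in E1.
  - by rewrite Est in E1.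
  - by case: nidle.
  by exists (rcons acks1 s) => //; move: E1; rewrite Est => -[-> _].
pose P j s := exists2 acks', w_status (gW (sigma j) w) = WAck V t acks' & s \in acks'.
have grow j s : i0 <= j -> P j s -> P j.+1 s.
  move=> ij [acks' Est sa]; have [a [o [d [ts _]]]] := run_step j.
  case: (tstep_writer_busy ts (busy ij)) => [[cut E]|[src [p [cut [st [o' [wc E]]]]]]].
    by exists acks'; rewrite ?E.
  have [acks2 E2 _] := ack j.+1 (leqW ij).
  case: wc E => [_ _|s1 op1 v1 r1 t1 tm _ _ E1|s1 op1 v1 r1 t1 _ _ E1 _|t1 acks1 E1|s1 t1
      acks1 _ _ E1 _] E;
    try by rewrite Est in E1.
  - by exists acks'; rewrite ?E.
  - by rewrite E in E2.
  exists (rcons acks1 s1); first by rewrite E; move: E1; rewrite Est => -[->].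
  by move: E1; rewrite Est mem_rcons in_cons => -[_ <-]; rewrite sa orbT.
have [_ sz al _ _] : [/\ t.2 = w, size acks < k n f e,
    forall x : 'I_n, x < f.+1 -> sent_to (past i0) id x, True & True].
  by have := inv_W (run_inv i0) w; rewrite /writer_inv Est0 => -[h1 h2 /(_ (w_live i0)) h3 _
      _].
have [j1 ij1 sn] := sent_all_seen al.
have [||j ij H] := @eventually_all _ P j1 N.
- move=> j l s ij; elim: l => [|l IH]; first by rewrite leqn0 => /eqP ->.
  rewrite leq_eqVlt => /orP[/eqP -> //|jl] /(IH jl); apply: grow; lia.
- move=> s sN; have [acks1 E1 Eop] := ack j1 ij1.
  have := inv_W (run_inv j1) w; rewrite /writer_inv E1 Eop => -[_ _ _ _ /(_ s (N_live sN j1)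
      (sn s sN))].
  case=> [sa|/delivery/(_ w_live)[j [jj [o [ts _]]]]]; first by exists j1 => //; exists acks1.
  have ij : i0 <= j by lia.
  exists j.+1; first by lia.
  have [acks2 E2 _] := ack j ij; have [acks3 E3 _] := ack j.+1 (leqW ij).
  have [cut [st [o' [wc E]]]] := tstep_at_writer ts.
  case: wc E => [_ own|s1 op1 v1 r1 t1 tm _ _ E4|s1 op1 v1 r1 t1 _ _ E4 _|t1 acks4 E4|s1 t1
      acks4 Es _ E4 _] E;
    try by rewrite E2 in E4.
  + by exists acks2; [rewrite E|exact: own erefl erefl E2].
  + by rewrite E in E3.
  exists (rcons acks4 s1); first by rewrite E; move: E4; rewrite E2 => -[->].
  by case: Es => ->; rewrite mem_rcons mem_head.
have [acks1 E1 _] : exists2 acks1, w_status (gW (sigma j) w) = WAck V t acks1 & True.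
  by have [|acks1 E1 _] := ack j; [lia|exists acks1].
have := inv_W (run_inv j) w; rewrite /writer_inv E1 => -[_ szj _ _ _].
have : size N <= size acks1.
  by apply: uniq_leq_size => // s /H[acks2]; rewrite E1 => -[->].
by move: szj N_big; rewrite /k; lia.
Qed.

End WriterProgress.

(** * A reader that stays busy leads to a contradiction *)

Section ReaderProgress.
Variables (r i0 : nat).
Hypothesis r_live : forall j, ~~ r_crashed (gR (sigma j) r).
Hypothesis busy : forall j, i0 <= j -> r_status (gR (sigma j) r) <> RIdle n C.

Lemma reader_leaves_query op reps : r_status (gR (sigma i0) r) = RQuery C op reps ->
  exists j tr pairs, i0 <= j /\ r_status (gR (sigma j) r) = RColl op tr pairs.
Proof.
move=> Est0; apply: NNPP => no.
have query j : i0 <= j -> exists reps', r_status (gR (sigma j) r) = RQuery C op reps'.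
  elim: j => [|j IH]; first by rewrite leqn0 => /eqP <-; exists reps.
  rewrite leq_eqVlt => /orP[/eqP <-|ij]; first by exists reps.
  have [reps' Est] := IH ij; have [a [o [d [ts _]]]] := run_step j.
  case: (tstep_reader_busy ts (busy ij)) => [[cut ->]|[src [p [cut [st [o' [rc E]]]]]]].
    by exists reps'.
  rewrite E; case: rc E => [_ _|s op1 r1 t _ _ E1 tr|s op1 r1 t _ _ E1 _|op1 tr pairs v E1|s
      op1 tr pairs t c _ _ E1 _] E;
    try by rewrite Est in E1.
  - by exists reps'.
  - case: no; exists j.+1, tr, [::]; split; first by lia.
    by rewrite E; move: E1; rewrite Est => -[<- _].
  by exists (rcons r1 (s, t)); move: E1; rewrite Est => -[-> _].
apply: (query_majority (i := i0) (c := PR r) (op := op)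
  (waiting := fun j reps => r_status (gR (sigma j) r) = RQuery C op reps)) => //.
- move=> j ij; have [reps' Est] := query j ij.
  have := inv_R (run_inv j) r; rewrite /reader_inv Est => -[_ h2 _ h4].
  by exists reps'; split=> //; exact: h4.
- move=> j reps1 ij Est; have [a [o [d [ts _]]]] := run_step j.
  case: (tstep_reader_busy ts (busy ij)) => [[cut E]|[src [p [cut [st [o' [rc E]]]]]]].
    by exists reps1 => //; rewrite E.
  have [reps2 Est2] := query j.+1 (leqW ij).
  case: rc E => [_ _|s op1 r1 t _ _ E1 tr|s op1 r1 t _ _ E1 _|op1 tr pairs v E1|s op1 tr
      pairs t c _ _ E1 _] E;
    try by rewrite Est in E1.
  + by exists reps1 => //; rewrite E.
  + by rewrite E in Est2.
  exists (rcons r1 (s, t)); first by move: E1; rewrite E Est => -[-> _].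
  move=> x; move: E1; rewrite Est => -[_ ->].
  by rewrite /unzip1 map_rcons mem_rcons in_cons orbC => ->.
- move=> j s t o ij ts; have [reps1 Est] := query j ij.
  have [reps2 Est2] := query j.+1 (leqW ij).
  have [cut [st [o' [rc E]]]] := tstep_at_reader ts.
  case: rc E => [own _|s1 op1 r1 t1 _ _ E1 tr|s1 op1 r1 t1 Es _ E1 _|op1 tr pairs v E1|s1
      op1 tr pairs t1 c _ _ E1 _] E;
    try by rewrite Est in E1.
  + by exists reps1; [rewrite E|exact: own erefl erefl Est].
  + by rewrite E in Est2.
  exists (rcons r1 (s1, t1)); first by move: E1; rewrite E Est => -[-> _].
  by case: Es => ->; rewrite /unzip1 map_rcons mem_rcons mem_head.
by move=> j r1 r2 ->  -[].
Qed.

Section Collecting.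
Variables (op : nat) (tr : Defs.tag) (pairs0 : seq ('I_n * Defs.tag * C)).
Hypothesis Est0 : r_status (gR (sigma i0) r) = RColl op tr pairs0.
Let rd : rid := (r, op).

Let coll j : i0 <= j -> exists pairs, r_status (gR (sigma j) r) = RColl op tr pairs.
Proof.
elim: j => [|j IH]; first by rewrite leqn0 => /eqP <-; exists pairs0.
rewrite leq_eqVlt => /orP[/eqP <-|ij]; first by exists pairs0.
have [pairs Est] := IH ij; have [a [o [d [ts _]]]] := run_step j.
have nidle := busy (leqW ij).
case: (tstep_reader_busy ts (busy ij)) => [[cut ->]|[src [p [cut [st [o' [rc E]]]]]]].
  by exists pairs.
rewrite E in nidle *; case: rc nidle => [_ _|s op1 r1 t _ _ E1 tr1|s op1 r1 t _ _ E1 _|op1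
    tr1 pairs1 v E1|s op1 tr1 pairs1 t c _ _ E1 _] nidle;
  try by rewrite Est in E1.
- by exists pairs.
by exists (rcons pairs1 (s, t, c)); move: E1; rewrite Est => -[-> -> _].
Qed.

Let unfinished j : i0 <= j -> ~ finished (sigma j) rd.
Proof.
move=> ij; have [pairs Est] := coll ij.
have := inv_R (run_inv j) r; rewrite /reader_inv Est => -[Eop _ _ _ _].
by rewrite /finished /= Eop ltnn Est => -[|[]].
Qed.

Let data_past j s t : i0 <= j -> data_sent (sigma j) (past j) s t rd ->
  exists c, past j (PS s) (PR r) (PData rd t c).
Proof. by move=> /unfinished nf [/nf|]. Qed.

Let data_later j l s t : i0 <= j -> j <= l -> data_sent (sigma j) (past j) s t rd ->
  data_sent (sigma l) (past l) s t rd.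
Proof.
move=> ij jl /(data_past ij)[c H]; right; exists c; exact: past_mono jl _ _ _ H.
Qed.

Let received j s t := exists2 pairs, r_status (gR (sigma j) r) = RColl op tr pairs &
    collected pairs s t.

Let received_later j l s t : i0 <= j -> j <= l -> received j s t -> received l s t.
Proof.
move=> ij; elim: l => [|l IH]; first by rewrite leqn0 => /eqP ->.
rewrite leq_eqVlt => /orP[/eqP -> //|jl] /(IH jl)[pairs Est ct].
have il : i0 <= l by lia.
have [a [o [d [ts _]]]] := run_step l; have [pairs2 Est2] := coll (leqW il).
case: (tstep_reader_busy ts (busy il)) => [[cut E]|[src [p [cut [st [o' [rc E]]]]]]].
  by exists pairs; rewrite ?E.
case: rc E => [_ _|s1 op1 r1 t1 _ _ E1 tr1|s1 op1 r1 t1 _ _ E1 _|op1 tr1 pairs1 v E1|s1 op1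
    tr1 pairs1 t1 c _ _ E1 _] E;
  try by rewrite Est in E1.
- by exists pairs; rewrite ?E.
- by rewrite E in Est2.
move: E1; rewrite Est => -[E1 E2 E3]; exists (rcons pairs1 (s1, t1, c)).
  by rewrite E E1 E2.
by rewrite -E3 /collected has_rcons; apply/orP; right.
Qed.

Let data_received j s t : i0 <= j -> data_sent (sigma j) (past j) s t rd ->
  exists2 l, j <= l & received l s t.
Proof.
move=> ij /(data_past ij)[c H]; have [pairs Est] := coll ij.
have := inv_R (run_inv j) r; rewrite /reader_inv Est => -[_ _ _ /(_ s t c H) + _].
case=> [ct|[c' /delivery/(_ r_live)[l [jl [o [ts _]]]]]]; first by exists j => //; exists
    pairs.
exists l.+1; first by lia.
have il : i0 <= l by lia.
have [pairs1 Est1] := coll il; have [pairs2 Est2] := coll (leqW il).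
have [cut [st [o' [rc E]]]] := tstep_at_reader ts.
case: rc E => [_ own|s1 op1 r1 t1 _ _ E1 tr1|s1 op1 r1 t1 _ _ E1 _|op1 tr1 pairs3 v E1|s1
    op1 tr1 pairs3 t1 c1 Es Ep E1 _] E;
  try by rewrite Est1 in E1.
- by exists pairs1; [rewrite E|exact: own erefl erefl Est1].
- by rewrite E in Est2.
move: E1; rewrite Est1 => -[E1 E2 E3]; exists (rcons pairs3 (s1, t1, c1)).
  by rewrite E E1 E2.
case: Es Ep => -> [_ -> _].
by rewrite /collected has_rcons /= !eqxx.
Qed.

(** Both the final contradiction and the reason why no live server forgets the reader: elements sent
    to a live reader are received, and those of one tag would exceed the bound in [reader_inv]. *)
Let not_enough j : i0 <= j -> ~ enough f (sigma j) (past j) rd.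
Proof.
move=> ij [t [S [uS sS dS]]].
have [||l jl H] := @eventually_all _ (fun l s => received l s t) j S.
- by move=> l l' s il ll; apply: received_later => //; lia.
- by move=> s /dS; apply: data_received.
have [|pairs Est] := @coll l; first by lia.
have := inv_R (run_inv l) r; rewrite /reader_inv Est => -[_ _ /(_ t) sz _ _].
have : size S <= size [seq x.1.1 | x <- [seq x <- pairs | x.1.2 == t]].
  apply: uniq_leq_size => // s /H[pairs']; rewrite Est => -[<-].
  rewrite /collected; elim: (pairs) => //= x ps IH.
  case: (x.1.2 == t); rewrite ?andbT ?andbF //= in_cons => /orP[/eqP ->|/IH ->];
    by rewrite ?eqxx ?orbT.
(* Positivity of [k] gives [k + 2 * e = n - f] in spite of truncated subtraction. *)
by rewrite size_map; move: sz sS k_gt0; rewrite /k; lia.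
Qed.

(** As [enough] is excluded, the server holds some pair for the reader; [si_R] ties its tag to the
    phase of the reader, which makes it [tr]. *)
Let registered_at j s : i0 <= j -> live s -> rv_id n rd \in s_seen (gS (sigma j) s) ->
  (rd, tr) \in s_R (gS (sigma j) s).
Proof.
move=> ij lv sn; case: (si_reg (inv_S (run_inv j) s) (lv j) sn) => [[tr' inR]|/(not_enough
    ij) //].
have [_ [/(unfinished ij) //|[pairs /= E]]] := si_R (inv_S (run_inv j) s) inR.
by have [pairs1] := coll ij; rewrite E => -[<- _].
Qed.

(** The identifier becomes seen in this step, so the handled message carries it. Having a tag, it
    belongs to a writer, so the message is a value, and [value_deliver] serves every registered
    reader whose tag is at most [t]. *)
Let data_on_delivery j s id t : i0 <= j -> live s -> (rd, tr) \in s_R (gS (sigma j) s) ->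
  id \notin s_seen (gS (sigma j) s) -> id \in s_seen (gS (sigma j.+1) s) ->
  id_tag (past j) id t -> tag_le tr t ->
  data_sent (sigma j.+1) (past j.+1) s t rd.
Proof.
move=> ij lv inR nsn sn it le_t; have I := run_inv j.
have [a [o [d [ts ns]]]] := run_step j; rewrite (past_step ns).
have old : gS (sigma j.+1) = gS (sigma j) -> False by move=> E; rewrite E (negPf nsn) in sn.
case: ts ns => {a o d} [s' src p err cut st o u _ inn /(server_recvP v0) rc ES _ _
  |w v cut st o _ _ _ _ ES _|w src p cut st o _ _ _ _ ES _|r' cut st o _ _ _ _ ES _
  |r' src p cut st o _ _ _ _ ES _|a HS _ _] ns; try by case: (old ES).
  have E : s = s'.
    by apply/eqP; apply: contraNT nsn => ne; move: sn; rewrite ES (negPf ne).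
  subst s'; have := lv j.+1; rewrite ES eqxx => /cut_crash_alive[Ec _].
  rewrite ES eqxx /= in sn.
  have pok := inv_msg I (inv_net I inn).
  case: (recv_caseE rc) => [[Est _]|[id' [t' [c [fp [o2 [pi pv Eo E]]]]]]|[id' [m [fp [o2
      [[Ep _] _ _ Esn _]]]]]].
  - by rewrite Est (negPf nsn) in sn.
  - move: E; rewrite value_deliverE => -[Est Eo2].
    rewrite -Est /= in_cons (negPf nsn) orbF in sn; rewrite -(eqP sn) in pv.
    have Et : t' = t.
      by apply: (inv_tag I _ it); exists src, (PS s), p; split=> //; apply: (inv_net I inn).
    right; exists c; right; split=> //; rewrite Ec /= Eo In_cat -Eo2 -cats1 In_cat; right;
        left.
    rewrite -Et; apply: (@In_data_blocks _ _ _ _ _ _ _ _ _ (rd, tr)).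
    by rewrite mem_filter /= Et le_t.
  rewrite Esn in_cons (negPf nsn) orbF in sn; have [w ew _] := inv_id_tag I it.
  move: pok; rewrite Ep -(eqP sn) => -[_].
  by case: m {Ep} => [rd' tr'|rd' tr'|t' s' rd'] [Eid _]; move: ew; rewrite ?Eid //; case:
      Eid => x ->.
by case: (HS s) => E; rewrite E (negPf nsn) in sn.
Qed.

Let max_server j : exists2 m, m \in N &
  forall s, s \in N -> tag_le (s_tag (gS (sigma j) s)) (s_tag (gS (sigma j) m)).
Proof.
elim: N q qN => // s l IH y _.
case: l IH => [|x l] IH.
  by exists s; [apply: mem_head|move=> z; rewrite inE => /eqP ->; apply: tag_le_refl].
have [m ml mx] := IH x (mem_head _ _).
case/orP: (tag_le_total (s_tag (gS (sigma j) m)) (s_tag (gS (sigma j) s))) => h.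
  exists s; first exact: mem_head.
  move=> z; rewrite in_cons => /orP[/eqP ->|/mx h']; first exact: tag_le_refl.
  exact: tag_le_trans h' h.
exists m; first by rewrite in_cons ml orbT.
by move=> z; rewrite in_cons => /orP[/eqP ->|/mx].
Qed.

Lemma collecting_ends : False.
Proof.
have [_ spr _ _ /(_ (r_live i0)) rvs] : [/\ True, spread f (past i0) tr, True, True &
    ~~ r_crashed (gR (sigma i0) r) -> forall x : 'I_n, x < f.+1 ->
      sent_to (past i0) (rv_id n rd) x].
  by have := inv_R (run_inv i0) r; rewrite /reader_inv Est0 => -[].
have [j1 ij1 rv_seen] := sent_all_seen rvs.
have [j2 ij2 tags] : exists2 j, i0 <= j &
    forall s, s \in N -> tag_le tr (s_tag (gS (sigma j) s)).
  case: spr => [->|[id it /sent_all_seen[j ij sn]]].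
    by exists i0 => // s _; apply: t0_le.
  exists j => // s /sn sns; apply: (si_tag (inv_S (run_inv j) s) sns).
  exact: id_tag_mono (past_mono ij) it.
pose T := maxn j1 j2; have iT : i0 <= T by lia.
have tagsT s : s \in N -> tag_le tr (s_tag (gS (sigma T) s)).
  move=> /tags h; have [_ h' _] := run_server_mono s (leq_maxr j1 j2).
  exact: tag_le_trans h h'.
have seenT j s : T <= j -> s \in N -> rv_id n rd \in s_seen (gS (sigma j) s).
  move=> Tj /rv_seen h; have j1j : j1 <= j by lia.
  by have [h' _ _] := run_server_mono s j1j; apply: h'.
have regT j s : T <= j -> s \in N -> (rd, tr) \in s_R (gS (sigma j) s).
  by move=> Tj sN; apply: registered_at (seenT _ _ Tj sN); [lia|exact: N_live].
have own s : s \in N -> data_sent (sigma T) (past T) s (s_tag (gS (sigma T) s)) rd.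
  move=> sN; exact: (si_data (inv_S (run_inv T) s) (N_live sN T) (regT _ _ (leqnn T) sN)
      (tagsT _ sN)).
have [m mN mx] := max_server T; set tm := s_tag (gS (sigma T) m) in mx.
have [l Tl all] : exists2 l, T <= l &
    forall s, s \in N -> data_sent (sigma l) (past l) s tm rd.
  (* The initial tag has no identifier behind it; if it is the maximum, all of [N] stores it and has
     already sent its element. *)
  case: (si_orig (inv_S (run_inv T) m)) => [E|[id sn it]].
    exists T => // s sN; rewrite /tm E (tag_le_anti (t0_le (s_tag (gS (sigma T) s))) _).
      exact: own.
    by have := mx s sN; rewrite /tm E.
  have [l Tl sns] := seen_all_seen (N_live mN) sn.
  exists l => // s sN.
  (* If [s] has seen [id] by time [T], its tag is at least [tm], hence equal to it by maximality.
     Otherwise some step after [T] makes [id] seen, and [s] is registered at that moment. *)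
  case: (boolP (id \in s_seen (gS (sigma T) s))) => [sT|nsT].
    have le := si_tag (inv_S (run_inv T) s) sT it.
    rewrite /tm (tag_le_anti le (mx s sN)); apply: data_later (own s sN) => //.
  have [] := @first_change (fun j => id \notin s_seen (gS (sigma j) s)) T l Tl nsT.
    by rewrite (sns s sN).
  move=> j [Tj jl nsj /negP/negPn snj].
  apply: (@data_later j.+1) => //; first by lia.
  apply: data_on_delivery snj _ _ => //.
  - by lia.
  - exact: N_live.
  - exact: regT.
  - exact: id_tag_mono (past_mono Tj) it.
  exact: tagsT.
apply: (@not_enough l); first by lia.
by exists tm, N; split.
Qed.

End Collecting.
End ReaderProgress.
End LiveSet.

Lemma client_completes (p : proc) : is_client p -> (forall j, ~~ crashed (sigma j) p) ->
  forall i, exists j, i <= j /\ client_idle (sigma j) p.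
Proof.
move=> cl al i; apply: NNPP => no.
have busy j : i <= j -> ~ client_idle (sigma j) p by move=> ij idl; apply: no; exists j.
have [N [uN bN lN [q qN qf]]] := live_servers.
case: p cl al busy {no} => [w|r|s] // _ al busy.
  have ack j t acks : i <= j -> w_status (gW (sigma j) w) <> WAck V t acks.
    move=> ij; apply: (writer_gets_acks uN bN lN qN qf al) => l jl.
    by apply: busy; lia.
  case Est: (w_status (gW (sigma i) w)) => [|op v reps|t acks].
  - exact: busy (leqnn i) Est.
  - have [j [t [acks [ij]]]] := writer_leaves_query uN bN lN qN qf al busy Est.
    exact: ack.
  exact: ack (leqnn i) Est.
have coll j op tr pairs : i <= j -> r_status (gR (sigma j) r) <> RColl op tr pairs.
  move=> ij Est; apply: (collecting_ends uN bN lN qN qf al _ Est) => l jl.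
  by apply: busy; lia.
case Est: (r_status (gR (sigma i) r)) => [|op reps|op tr pairs].
- exact: busy (leqnn i) Est.
- have [j [tr [pairs [ij]]]] := reader_leaves_query uN bN lN qN qf al busy Est.
  exact: coll.
exact: coll (leqnn i) Est.
Qed.

End Liveness.

Theorem theorem10 (n f e : nat) (V C : Type)
    (Phi : 'I_n -> V -> C) (Dec : seq ('I_n * C) -> V) (v0 : V) :
  1 <= f -> f <= (n - 1) %/ 2 -> 0 < k n f e ->
  err_decoder f e Phi Dec ->
  forall sigma : nat -> gstate n V C,
    execution f e Phi Dec v0 sigma ->
    reliable_channels sigma ->
    at_most_f_server_crashes f sigma ->
    at_most_e_errors e sigma ->
    forall p : proc n, is_client p ->
      (forall j, ~~ crashed (sigma j) p) ->
      forall i, exists j, i <= j /\ client_idle (sigma j) p.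
Proof.
move=> _ f_small k_gt0 _ sigma exec rel few _ p cl al i.
exact: (client_completes f_small k_gt0 exec rel few cl al).
Qed.
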